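(* Let $V$ be a vertex operator algebra satisfying: (1) $V$ is $C_1$-cofinite; (2) there exists a positive integer $N$ such that $|\Re(n_1)-\Re(n_2)|\le N$ for the lowest weights $n_1$ and $n_2$ of any two irreducible $V$-modules and such that the associative algebra $A_N(V)$ is finite dimensional. Then the category of grading-restricted generalized $V$-modules, the category of quasi-finite-dimensional generalized $V$-modules and the category of finite length generalized $V$-modules are the same.
   Context: $V=\coprod_{n\in\mathbb Z}V_{(n)}$ is a vertex operator algebra over $\mathbb C$ (with $\dim V_{(n)}<\infty$ and $V_{(n)}=0$ for $n$ sufficiently negative), $Y(u,x)=\sum_{n\in\mathbb Z}u_nx^{-n-1}$, $V_+=\coprod_{n>0}V_{(n)}$. A generalized $V$-module is a $\mathbb C$-graded space $W=\coprod_{n\in\mathbb C}W_{[n]}$ with a vertex operator map $Y_W:V\otimes W\to W((x))$ satisfying all axioms for $V$-modules except the two grading-restriction conditions (finite-dimensionality and lower truncation of the grading), and with the $L(0)$-grading property weakened to: $W_{[n]}$ is the generalized eigenspace of $L(0)$ with eigenvalue $n$. It is lower truncated if $W_{[n]}=0$ when $\Re(n)$ is sufficiently negative; grading restricted if it is lower truncated and $\dim W_{[n]}<\infty$ for all $n$; quasi-finite dimensional if $\dim\coprod_{\Re(n)\le R}W_{[n]}<\infty$ for every $R\in\mathbb R$; a (ordinary) $V$-module if it is grading restricted and $L(0)$ acts semisimply. Irreducible means nonzero with no proper nonzero generalized submodule. The lowest weight of a lower-truncated $W$, if it exists, is the $n_0\in\mathbb C$ with $W_{[n_0]}\neq0$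 and $W_{[n]}=0$ whenever $\Re(n)<\Re(n_0)$, or $\Re(n)=\Re(n_0)$ and $n\ne n_0$; irreducible $V$-modules have lowest weights. $W$ is of finite length if there are generalized submodules $W=W_1\supset\cdots\supset W_{l+1}=0$ for some $l\ge 0$ with each $W_i/W_{i+1}$ an irreducible $V$-module. All three categories are full subcategories of the category of generalized $V$-modules. $V$ is $C_1$-cofinite (in the sense of Li) if $V/C_1(V)$ is finite dimensional, where $C_1(V)$ is spanned by $u_{-1}v$ for $u,v\in V_+$ and $L(-1)v$ for $v\in V$. For $n\in\mathbb N$, $A_n(V)=V/O_n(V)$ is the (Zhu, Dong–Li–Mason) associative algebra with product induced by $u*_nv=\sum_{m=0}^n(-1)^m\binom{m+n}{n}\mathrm{Res}_x\,x^{-n-m-1}Y((1+x)^{L(0)+n}u,x)v$, where $O_n(V)$ is spanned by $\mathrm{Res}_x\,x^{-2n-2}Y((1+x)^{L(0)+n}u,x)v$ for $u,v\in V$ and $(L(-1)+L(0))u$ for $u\in V$. *)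

(* Defs.v *)
From HB Require Import structures.
From mathcomp Require Import all_boot all_order all_algebra.
From mathcomp Require Import boolp classical_sets reals complex.

Set Implicit Arguments.
Unset Strict Implicit.
Unset Printing Implicit Defensive.
Import Order.TTheory GRing.Theory Num.Theory.
Local Open Scope ring_scope.
Local Open Scope quotient_scope.

Section Span.
Variables (K : fieldType) (V : lmodType K).

Definition lspan (A : set V) : {pred V} :=
  [pred w | `[< exists s : seq (K * V),
    (forall p, p \in s -> A p.2) /\ w = \sum_(p <- s) p.1 *: p.2 >] ].

Lemma lspan_closed (A : set V) : submod_closed (lspan A).
Proof.
split; first by apply/asboolP; exists [::]; split=> //; rewrite big_nil.
move=> a u v /asboolP[s [sA ->]] /asboolP[t [tA ->]]; apply/asboolP.
exists ([seq (a * p.1, p.2) | p <- s] ++ t); split.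
  move=> p; rewrite mem_cat => /orP[/mapP[q qs ->]|/tA//] /=; exact: sA.
rewrite big_cat big_map scaler_sumr /=; congr (_ + _).
by apply: eq_bigr => p _; rewrite scalerA.
Qed.
HB.instance Definition _ (A : set V) :=
  GRing.isSubmodClosed.Build K V (lspan A) (lspan_closed A).

Definition fin_dim (S : {pred V}) : Prop :=
  exists s : seq V, S =i lspan [set x | x \in s].

(* V is the internal direct sum of the G i. *)
Definition direct_sum (I : eqType) (G : I -> submodClosed V) : Prop :=
  (forall w, exists s : seq I, exists f : I -> V,
     [/\ uniq s, forall i, f i \in G i & w = \sum_(i <- s) f i]) /\
  (forall (s : seq I) (f : I -> V), uniq s -> (forall i, f i \in G i) ->
     \sum_(i <- s) f i = 0 -> forall i, i \in s -> f i = 0).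

End Span.

Section QuotientSpace.
Variables (K : fieldType) (V : lmodType K) (S : submodClosed V).

(* Repackages S as a predicate with the zmodClosed structure that ring_quotient
   requires, which submodClosed does not carry. *)
Definition submod_pred : {pred V} := [pred v | v \in S].

Lemma submod_pred_closed : zmod_closed submod_pred.
Proof.
split=> [|u v]; rewrite !inE; first exact: rpred0.
by move=> uS vS; rewrite -scaleN1r rpredD // rpredZ.
Qed.
HB.instance Definition _ := GRing.isZmodClosed.Build V submod_pred submod_pred_closed.

Local Notation Q := (ring_quotient.Quotient.quot submod_pred).

Lemma quot_eq (u v : V) : (\pi_Q u == \pi_Q v) = (u - v \in S).
Proof. by rewrite -ring_quotient.Quotient.idealrBE. Qed.

Definition quot_scale (a : K) (x : Q) : Q := \pi_Q (a *: repr x).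

Lemma quot_scale_pi a v : quot_scale a (\pi_Q v) = \pi_Q (a *: v).
Proof.
apply/eqP; rewrite quot_eq -scalerBr; apply: rpredZ.
by rewrite -quot_eq reprK.
Qed.

Lemma quot_pi_add : {morph \pi_Q : u v / u + v}.
Proof. by move=> u v; rewrite !piE. Qed.

Fact quot_scaleA a b x : quot_scale a (quot_scale b x) = quot_scale (a * b) x.
Proof. by rewrite -[x]reprK (quot_scale_pi b) !quot_scale_pi scalerA. Qed.

Fact quot_scale1 : left_id 1 quot_scale.
Proof. by move=> x; rewrite -[x]reprK quot_scale_pi scale1r. Qed.

Fact quot_scaleDr : right_distributive quot_scale +%R.
Proof.
move=> a x y; rewrite -[x]reprK -[y]reprK -quot_pi_add !quot_scale_pi.
by rewrite -quot_pi_add scalerDr.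
Qed.

Fact quot_scaleDl x : {morph quot_scale^~ x : a b / a + b}.
Proof.
by move=> a b; rewrite -[x]reprK !quot_scale_pi -quot_pi_add scalerDl.
Qed.

Definition quot_space : Type := Q.
HB.instance Definition _ := GRing.Zmodule.on quot_space.
HB.instance Definition _ := GRing.Zmodule_isLmodule.Build K quot_space
  quot_scaleA quot_scale1 quot_scaleDr quot_scaleDl.

Definition quot_pi (v : V) : quot_space := \pi_Q v.

Fact quot_pi_linear : linear quot_pi.
Proof. by move=> a u v; rewrite /quot_pi quot_pi_add -quot_scale_pi. Qed.
HB.instance Definition _ := GRing.isLinear.Build K V quot_space _ quot_pi
  quot_pi_linear.

Lemma quot_pi_eq0 v : (quot_pi v == 0) = (v \in S).
Proof. by rewrite -(raddf0 quot_pi) /quot_pi quot_eq subr0. Qed.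

Lemma quot_pi_repr (x : quot_space) : quot_pi (repr (x : Q)) = x.
Proof. exact: reprK. Qed.

End QuotientSpace.

Section SubSpace.
Variables (K : fieldType) (V : lmodType K) (S : submodClosed V).

Definition sub_space : Type := {v : V | v \in S}.
HB.instance Definition _ := [isSub of sub_space for @sval _ _].
HB.instance Definition _ := [Choice of sub_space by <:].
HB.instance Definition _ := [SubChoice_isSubLmodule of sub_space by <:].

Lemma sub_val_linear : linear (val : sub_space -> V).
Proof. exact: linearP. Qed.

End SubSpace.

Section VertexOperatorAlgebra.
Variable R : realType.
Local Notation C := R[i].
Local Notation Re := complex.Re.

(* The binomial coefficient m(m-1)...(m-i+1)/i! for an arbitrary integer m. *)
Definition binz (m : int) (i : nat) : C :=
  (\prod_(j < i) (m%:~R - j%:R)) / i`!%:R.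

(* A vertex operator map from V (x) W to W((x)) is given by its components:
   Y u n w is the element u_n w, the coefficient of x^(-n-1) in Y(u,x)w.
   The Virasoro operators are L(n) = omega_(n+1). *)
Definition vir (V W : Type) (Y : V -> int -> W -> W) (omega : V) (n : int) :
  W -> W := Y omega (n + 1).

(* The axioms shared by vertex operator algebras (W = V, YW = Y) and their
   modules.  [va_jacobi] is the coefficient of x_0^(-l-1) x_1^(-m-1) x_2^(-n-1)
   in the Jacobi identity
     x_0^-1 delta((x_1 - x_2)/x_0) Y_W(u,x_1) Y_W(v,x_2) w
     - x_0^-1 delta((x_2 - x_1)/(-x_0)) Y_W(v,x_2) Y_W(u,x_1) w
     = x_2^-1 delta((x_1 - x_0)/x_2) Y_W(Y(u,x_0)v,x_2) w.
   By [va_truncation] the sums over i have finitely many nonzero terms, so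
   their partial sums are eventually constant.
   [va_derivative] is Y_W(L(-1)u,x) = d/dx Y_W(u,x). *)
Record vertex_action (V : lmodType C) (Y : V -> int -> V -> V) (one omega : V)
    (c : C) (W : lmodType C) (YW : V -> int -> W -> W) : Prop := VertexAction {
  va_linear_l : forall n w, linear (fun u => YW u n w);
  va_linear_r : forall u n, linear (YW u n);
  va_truncation : forall u w, exists N : int,
    forall n : int, N <= n -> YW u n w = 0;
  va_vacuum : forall n w, YW one n w = if n == -1 then w else 0;
  va_jacobi : forall u v w (l m n : int), exists N : nat, forall K : nat,
    (N <= K)%N ->
    \sum_(i < K) ((-1) ^+ i * binz l i) *:
       (YW u (m + l - i%:Z) (YW v (n + i%:Z) w)
        - (-1) ^ l *: YW v (n + l - i%:Z) (YW u (m + i%:Z) w))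
    = \sum_(i < K) binz m i *: YW (Y u (l + i%:Z) v) (m + n - i%:Z) w;
  va_virasoro : forall (m n : int) w,
    vir YW omega m (vir YW omega n w) - vir YW omega n (vir YW omega m w)
    = (m - n)%:~R *: vir YW omega (m + n) w
      + (if m + n == 0 then (m ^+ 3 - m)%:~R / 12%:R * c else 0) *: w;
  va_derivative : forall u (n : int) w,
    YW (vir Y omega (-1) u) n w = (- n)%:~R *: YW u (n - 1) w
}.

Record voa := VOA {
  voa_space :> lmodType C;
  voa_gr : int -> submodClosed voa_space;
  voa_Y : voa_space -> int -> voa_space -> voa_space;
  voa_one : voa_space;
  voa_omega : voa_space;
  voa_rank : C;
  voa_direct : direct_sum voa_gr;
  voa_gr_fin : forall n, fin_dim (voa_gr n);
  voa_gr_trunc : exists n0 : int, forall n : int, n < n0 ->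
    voa_gr n =i pred1 0;
  voa_one_gr : voa_one \in voa_gr 0;
  voa_omega_gr : voa_omega \in voa_gr 2;
  voa_action : vertex_action voa_Y voa_one voa_omega voa_rank voa_Y;
  voa_creation : forall v (n : int), -1 <= n ->
    voa_Y v n voa_one = if n == -1 then v else 0;
  voa_L0 : forall (n : int) v, v \in voa_gr n ->
    vir voa_Y voa_omega 0 v = n%:~R *: v
}.

Definition is_gen_eigenvector (W : lmodType C) (L : W -> W) (n : C) (w : W) :=
  exists k : nat, iter k (fun x => L x - n *: x) w = 0.

Record gen_module (V : voa) := GenModule {
  gm_space :> lmodType C;
  gm_gr : C -> submodClosed gm_space;
  gm_Y : V -> int -> gm_space -> gm_space;
  gm_direct : direct_sum gm_gr;
  gm_action : vertex_action (@voa_Y V) (voa_one V) (voa_omega V) (voa_rank V)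
                gm_Y;
  gm_L0 : forall (n : C) w, w \in gm_gr n <->
    is_gen_eigenvector (vir gm_Y (voa_omega V) 0) n w
}.

Definition voa_L (V : voa) (n : int) : V -> V := vir (@voa_Y V) (voa_omega V) n.
Definition gm_L (V : voa) (W : gen_module V) (n : int) : W -> W :=
  vir (@gm_Y V W) (voa_omega V) n.

(* A graded subspace, i.e. the sum of its intersections with the W_[n], stable
   under all the u_n. *)
Record gen_submodule (V : voa) (W : gen_module V) := GenSubmodule {
  gs_pred :> submodClosed W;
  gs_stable : forall u n w, w \in gs_pred -> gm_Y u n w \in gs_pred;
  gs_graded : forall w, w \in gs_pred -> exists s : seq C, exists f : C -> W,
    [/\ uniq s, forall n, f n \in gm_gr W n, forall n, f n \in gs_pred
      & w = \sum_(n <- s) f n]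
}.

Section Transport.
Variables (V : lmodType C) (Y : V -> int -> V -> V) (one omega : V) (c : C).
Variables (W W' : lmodType C) (YW : V -> int -> W -> W).
Variable YW' : V -> int -> W' -> W'.

Lemma va_transport_inj (f : {linear W' -> W}) : injective f ->
  (forall u n x, f (YW' u n x) = YW u n (f x)) ->
  vertex_action Y one omega c YW -> vertex_action Y one omega c YW'.
Proof.
have fZ a x : f (a *: x) = a *: f x by exact: linearZ_LR.
have fsum n (F : 'I_n -> _) :
  f (\sum_(i < n) F i) = \sum_(i < n) f (F i) by exact: (raddf_sum f).
have fB x y : f (x - y) = f x - f y by exact: raddfB.
have fD x y : f (x + y) = f x + f y by exact: raddfD.
move=> fI fY [ll lr tr va ja vi de]; split.
- by move=> n w a u v /=; apply: fI; rewrite linearP !fY ll.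
- by move=> u n a x y; apply: fI; rewrite linearP !fY linearP lr.
- move=> u w; have [N NP] := tr u (f w); exists N => n /NP e.
  by apply: fI; rewrite fY e raddf0.
- by move=> n w; apply: fI; rewrite fY va; case: ifP; rewrite ?raddf0.
- move=> u v w l m n; have [N NP] := ja u v (f w) l m n; exists N => K /NP e.
  apply: fI; rewrite !fsum.
  under eq_bigr do rewrite fZ fB fZ !fY.
  by rewrite e; apply: eq_bigr => i _; rewrite fZ fY.
- move=> m n w; apply: fI; rewrite /vir in vi *.
  by rewrite fB fD !fZ !fY vi.
- by move=> u n w; apply: fI; rewrite fZ !fY de.
Qed.

Lemma va_transport_surj (f : {linear W -> W'}) :
  (forall y, exists x, y = f x) ->
  (forall u n x, f (YW u n x) = YW' u n (f x)) ->
  vertex_action Y one omega c YW -> vertex_action Y one omega c YW'.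
Proof.
have fZ a x : f (a *: x) = a *: f x by exact: linearZ_LR.
have fsum n (F : 'I_n -> _) :
  f (\sum_(i < n) F i) = \sum_(i < n) f (F i) by exact: (raddf_sum f).
have fB x y : f (x - y) = f x - f y by exact: raddfB.
have fD x y : f (x + y) = f x + f y by exact: raddfD.
move=> fS fY [ll lr tr va ja vi de]; split.
- by move=> n _w a u v /=; have [w ->] := fS _w; rewrite -!fY ll linearP.
- move=> u n a _x _y; have [x ->] := fS _x; have [y ->] := fS _y.
  by rewrite -linearP -!fY lr linearP.
- move=> u _w; have [w ->] := fS _w; have [N NP] := tr u w; exists N => n /NP e.
  by rewrite -fY e raddf0.
- move=> n _w; have [w ->] := fS _w; rewrite -fY va.
  by case: ifP; rewrite ?raddf0.
- move=> u v _w l m n; have [w ->] := fS _w.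
  have [N NP] := ja u v w l m n; exists N => K /NP /(congr1 f).
  rewrite !fsum => e.
  under eq_bigr do rewrite -!fY -fZ -fB -fZ.
  by rewrite e; apply: eq_bigr => i _; rewrite fZ fY.
- move=> m n _w; have [w ->] := fS _w; rewrite /vir in vi *.
  by rewrite -!fY -fB vi fD !fZ.
- by move=> u n _w; have [w ->] := fS _w; rewrite -!fY de fZ.
Qed.

End Transport.

Lemma linear_subZ (W W' : lmodType C) (f : W -> W') : linear f ->
  forall a x y, f (x - a *: y) = f x - a *: f y.
Proof.
move=> lf a x y; have -> : x - a *: y = (- a) *: y + x by rewrite scaleNr addrC.
by rewrite lf scaleNr addrC.
Qed.

Section GenEigen.
Variables (W : lmodType C) (L : W -> W) (linL : linear L).
Local Notation A n := (fun x => L x - n *: x).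

Lemma shift_linear n : linear (A n).
Proof.
move=> a x y /=; rewrite [in RHS]scalerBr linL scalerDr opprD addrACA.
by rewrite !scalerA mulrC.
Qed.

Lemma iter_shift_linear n k : linear (iter k (A n)).
Proof.
by elim: k => [//|k IH] a x y; rewrite !iterS IH shift_linear.
Qed.

Lemma iter_shift0 n k : iter k (A n) 0 = 0.
Proof.
by have := iter_shift_linear n k (- 1) 0 0; rewrite !scaleN1r !addNr.
Qed.

Lemma iter_shift_sum n k (I : Type) (s : seq I) (f : I -> W) :
  iter k (A n) (\sum_(i <- s) f i) = \sum_(i <- s) iter k (A n) (f i).
Proof.
elim: s => [|i s IH]; first by rewrite !big_nil iter_shift0.
rewrite !big_cons -IH; have := iter_shift_linear n k 1 (f i).
by move=> /(_ (\sum_(j <- s) f j)); rewrite !scale1r.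
Qed.

Lemma shift_comm m n x : A m (A n x) = A n (A m x).
Proof.
rewrite /= !(linear_subZ linL) !scalerBr !scalerA mulrC !opprB.
rewrite -!addrA; congr (_ + _); rewrite addrCA [in RHS]addrC -!addrA.
by congr (_ + _); rewrite addrC.
Qed.

Lemma gen_eigen_disjoint m n x : m != n ->
  is_gen_eigenvector L m x -> is_gen_eigenvector L n x -> x = 0.
Proof.
move=> mn [j jx] [k kx].
have [N] := ubnP (j + k); elim: N j k x jx kx => // N IH.
case=> [|j] [|k] x jx kx // lt.
have icomm p q i y : iter i (A p) (A q y) = A q (iter i (A p) y).
  by elim: i => //= i ->; rewrite shift_comm.
have zA p : A p 0 = 0 by have := iter_shift0 p 1.
have m0 : A m x = 0.
  apply: (IH j k.+1); first by rewrite -iterSr.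
    by rewrite icomm kx zA.
  by rewrite addSn ltnS in lt.
have n0 : A n x = 0.
  apply: (IH j.+1 k); last by rewrite addnS ltnS in lt.
    by rewrite icomm jx zA.
  by rewrite -iterSr.
have /eqP : (m - n) *: x = 0.
  transitivity (A n x - A m x); last by rewrite n0 m0 subrr.
  by rewrite /= scalerBl opprB [RHS]addrC addrA subrK.
by rewrite scaler_eq0 subr_eq0 (negbTE mn) => /eqP.
Qed.

Lemma direct_sum_gen_eigen (G : C -> submodClosed W) : direct_sum G ->
  (forall n w, w \in G n -> L w \in G n) ->
  (forall n w, w \in G n -> is_gen_eigenvector L n w) ->
  forall n w, w \in G n <-> is_gen_eigenvector L n w.
Proof.
move=> [dec ind] GL Geig n w; split=> [/Geig//|ew].
have [s [f [us fG def_w]]] := dec w; case: ew => k; rewrite def_w => ew.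
have GA i j x : x \in G i -> iter j (A n) x \in G i.
  elim: j => //= j IH xG; have yG := IH xG.
  by rewrite -scaleNr rpredD ?rpredZ ?GL.
rewrite iter_shift_sum in ew.
have z := ind s (fun i => iter k (A n) (f i)) us (fun i => GA i k _ (fG i)) ew.
rewrite big_seq; apply: rpred_sum => i si; have [<-//|ni] := eqVneq i n.
rewrite (gen_eigen_disjoint ni (Geig _ _ (fG i))) ?rpred0 //.
by exists k; apply: z.
Qed.

End GenEigen.

Section Submodule.
Variables (V : voa) (W : gen_module V) (S : gen_submodule W).

Lemma vir_linear n : linear (vir (@gm_Y V W) (voa_omega V) n).
Proof. exact: (va_linear_r (gm_action W)). Qed.

Definition sub_gr (n : C) : {pred sub_space S} :=
  [pred x | val x \in gm_gr W n].

Lemma sub_gr_closed n : submod_closed (sub_gr n).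
Proof.
split=> [|a x y]; rewrite !inE ?raddf0 ?rpred0 // => xG yG.
by rewrite sub_val_linear rpredD ?rpredZ.
Qed.
HB.instance Definition _ n :=
  GRing.isSubmodClosed.Build C (sub_space S) (sub_gr n) (sub_gr_closed n).

Definition sub_Y (u : V) (n : int) (x : sub_space S) : sub_space S :=
  exist _ (gm_Y u n (val x)) (gs_stable u n (valP x)).

Lemma sub_direct : direct_sum (fun n => sub_gr n : submodClosed (sub_space S)).
Proof.
split=> [x|s f us fG e i si].
  have [s [f [us fG fS def_x]]] := gs_graded (valP x).
  exists s, (fun n => exist _ (f n) (fS n)); split=> //.
  by apply: val_inj; rewrite raddf_sum.
apply: val_inj.
have := (gm_direct W).2 s (fun n => val (f n)) us fG.
by rewrite raddf0 -raddf_sum e raddf0 => /(_ erefl i si).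
Qed.

Lemma sub_action : vertex_action (@voa_Y V) (voa_one V) (voa_omega V)
  (voa_rank V) sub_Y.
Proof.
exact: (@va_transport_inj _ _ _ _ _ _ _ _ _
          (val : {linear sub_space S -> W}) val_inj _ (gm_action W)).
Qed.

Lemma sub_L0 (n : C) x : x \in sub_gr n <->
  is_gen_eigenvector (vir sub_Y (voa_omega V) 0) n x.
Proof.
have e k : val (iter k (fun x => vir sub_Y (voa_omega V) 0 x - n *: x) x)
    = iter k (fun x => vir (@gm_Y V W) (voa_omega V) 0 x - n *: x) (val x).
  elim: k => // k; rewrite !iterS => <-; set y := iter k _ x.
  exact: (linear_subZ (@sub_val_linear _ _ S) n (vir sub_Y (voa_omega V) 0 y) y).
rewrite inE gm_L0; split=> -[k kx]; exists k.
  by apply: val_inj; rewrite e kx raddf0.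
by rewrite -e kx raddf0.
Qed.

Definition submodule : gen_module V :=
  GenModule sub_direct sub_action sub_L0.

Definition quot_gr (n : C) : {pred quot_space S} :=
  [pred x | `[< exists2 w, w \in gm_gr W n & x = quot_pi S w >] ].

Lemma quot_gr_closed n : submod_closed (quot_gr n).
Proof.
split; first by apply/asboolP; exists 0; rewrite ?rpred0 ?raddf0.
move=> a x y /asboolP[u uG ->] /asboolP[v vG ->]; apply/asboolP.
by exists (a *: u + v); rewrite ?quot_pi_linear // rpredD ?rpredZ.
Qed.
HB.instance Definition _ n :=
  GRing.isSubmodClosed.Build C (quot_space S) (quot_gr n) (quot_gr_closed n).

Definition quot_Y (u : V) (n : int) (x : quot_space S) : quot_space S :=
  quot_pi S (gm_Y u n (repr x)).

Lemma quot_piP (x : quot_space S) : exists w, x = quot_pi S w.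
Proof. by exists (repr x); rewrite quot_pi_repr. Qed.

Lemma quot_YE u n w : quot_pi S (gm_Y u n w) = quot_Y u n (quot_pi S w).
Proof.
apply/eqP; rewrite -subr_eq0 -raddfB quot_pi_eq0.
have lin := va_linear_r (gm_action W) u n.
have -> : gm_Y u n w - gm_Y u n (repr (quot_pi S w))
    = gm_Y u n (w - repr (quot_pi S w)).
  by have := linear_subZ lin 1 w (repr (quot_pi S w)); rewrite !scale1r.
by rewrite gs_stable // -quot_pi_eq0 raddfB /= quot_pi_repr subrr.
Qed.

Lemma quot_direct :
  direct_sum (fun n => quot_gr n : submodClosed (quot_space S)).
Proof.
split=> [_x|s g us gG e i si].
  have [x ->] := quot_piP _x.
  have [s [f [us fG def_x]]] := (gm_direct W).1 x.
  exists s, (fun n => quot_pi S (f n)); split=> //.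
    by move=> n; apply/asboolP; exists (f n).
  by rewrite def_x raddf_sum.
have /choice[f fP] : forall n, exists w, w \in gm_gr W n /\ g n = quot_pi S w.
  by move=> n; have /asboolP[w] := gG n; exists w.
have fG n : f n \in gm_gr W n by case: (fP n).
have gE n : g n = quot_pi S (f n) by case: (fP n).
have : \sum_(n <- s) f n \in S.
  rewrite -quot_pi_eq0 raddf_sum -[X in _ == X]e; apply/eqP.
  by apply: eq_bigr => n _; rewrite gE.
move=> /gs_graded[t [h [ut hG hS e']]].
pose r := undup (s ++ t).
pose d n := (if n \in s then f n else 0) - (if n \in t then h n else 0).
have dG n : d n \in gm_gr W n.
  by rewrite /d -scaleN1r rpredD ?rpredZ //; case: ifP; rewrite ?rpred0.
have extend (q : seq C) (k : C -> W) : uniq q -> {subset q <= r} ->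
    \sum_(n <- r) (if n \in q then k n else 0) = \sum_(n <- q) k n.
  move=> uq qr; rewrite -big_mkcond -big_filter; apply: perm_big.
  apply: uniq_perm => //; first by rewrite filter_uniq ?undup_uniq.
  by move=> n; rewrite mem_filter andb_idr //; apply: qr.
have d0 : \sum_(n <- r) d n = 0.
  rewrite sumrB !extend // ?e' ?subrr // => n nq.
    by rewrite mem_undup mem_cat nq orbT.
  by rewrite mem_undup mem_cat nq.
have ir : i \in r by rewrite mem_undup mem_cat si.
have := (gm_direct W).2 r d (undup_uniq _) dG d0 i ir.
rewrite /d si gE => /eqP; rewrite subr_eq0 => /eqP ->.
by case: ifP => _; apply/eqP; rewrite ?raddf0 // quot_pi_eq0.
Qed.

Lemma quot_action : vertex_action (@voa_Y V) (voa_one V) (voa_omega V)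
  (voa_rank V) quot_Y.
Proof.
exact: (@va_transport_surj _ _ _ _ _ _ _ _ _
          (quot_pi S : {linear W -> quot_space S}) quot_piP quot_YE
          (gm_action W)).
Qed.

Lemma quot_L0 (n : C) x : x \in quot_gr n <->
  is_gen_eigenvector (vir quot_Y (voa_omega V) 0) n x.
Proof.
pose L := vir (@gm_Y V W) (voa_omega V) 0.
have e m w k : quot_pi S (iter k (fun x => L x - m *: x) w)
    = iter k (fun x => vir quot_Y (voa_omega V) 0 x - m *: x) (quot_pi S w).
  elim: k => //= k <-.
  by rewrite (linear_subZ (@quot_pi_linear _ _ S)) quot_YE.
apply: (direct_sum_gen_eigen _ quot_direct).
- exact: (va_linear_r quot_action).
- move=> m _ /asboolP[w wG ->]; apply/asboolP; exists (L w).
    apply/gm_L0; have [k kw] := (gm_L0 _ _).1 wG; exists k.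
    have lin := iter_shift_linear (vir_linear 0) m k.
    have Lc : iter k (fun x => L x - m *: x) (L w - m *: w) = 0.
      rewrite -iterSr iterS kw.
      by have := iter_shift0 (vir_linear 0) m 1.
    have := lin m w (L w - m *: w).
    by rewrite [_ *: w + _]addrC subrK Lc kw scaler0 addr0.
  by rewrite quot_YE.
- move=> m _ /asboolP[w /gm_L0[k kw] ->]; exists k.
  by rewrite -e kw raddf0.
Qed.

Definition quotient_module : gen_module V :=
  GenModule quot_direct quot_action quot_L0.

End Submodule.

(* The quotient S / T of two generalized submodules of W. *)
Section Subquotient.
Variables (V : voa) (W : gen_module V) (S T : gen_submodule W).
Hypothesis TS : {subset T <= S}.

Definition restrict_pred : {pred submodule S} := [pred x | val x \in T].

Lemma restrict_closed : submod_closed restrict_pred.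
Proof.
split=> [|a x y]; rewrite !inE ?raddf0 ?rpred0 // => xT yT.
by rewrite (@sub_val_linear _ _ S) rpredD ?rpredZ.
Qed.
HB.instance Definition _ :=
  GRing.isSubmodClosed.Build C (submodule S) restrict_pred restrict_closed.

Lemma restrict_stable u n (x : submodule S) :
  x \in restrict_pred -> gm_Y u n x \in restrict_pred.
Proof. by move=> xT; apply: gs_stable. Qed.

Lemma restrict_graded (x : submodule S) : x \in restrict_pred ->
  exists s : seq C, exists f : C -> submodule S,
    [/\ uniq s, forall n, f n \in gm_gr (submodule S) n,
      forall n, f n \in restrict_pred & x = \sum_(n <- s) f n].
Proof.
move=> /gs_graded[s [f [us fG fT def_x]]].
exists s, (fun n => exist _ (f n) (TS (fT n))); split=> //.
by apply: val_inj; rewrite def_x raddf_sum.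
Qed.

Definition subquotient : gen_module V :=
  quotient_module (GenSubmodule restrict_stable restrict_graded).

End Subquotient.

Section ModuleClasses.
Variable V : voa.
Implicit Type W : gen_module V.

Definition lower_truncated W : Prop :=
  exists r : R, forall n : C, Re n < r -> gm_gr W n =i pred1 0.

Definition grading_restricted W : Prop :=
  lower_truncated W /\ forall n, fin_dim (gm_gr W n).

Definition quasi_finite_dimensional W : Prop :=
  forall r : R,
    fin_dim (lspan [set w | exists2 n : C, Re n <= r & w \in gm_gr W n]).

Definition L0_semisimple W : Prop :=
  lspan [set w | exists n : C, gm_L 0 w = n *: w] =i (predT : {pred W}).

Definition V_module W : Prop :=
  grading_restricted W /\ L0_semisimple W.

Definition irreducible W : Prop :=
  (exists w : W, w != 0) /\
    forall S : gen_submodule W, S =i pred1 0 \/ S =i predT.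

Definition irreducible_V_module W : Prop :=
  V_module W /\ irreducible W.

Definition lowest_weight W (n0 : C) : Prop :=
  ~ (gm_gr W n0 =i pred1 0) /\
  forall n : C, Re n < Re n0 \/ Re n = Re n0 /\ n <> n0 ->
    gm_gr W n =i pred1 0.

Definition finite_length W : Prop :=
  exists (l : nat) (F : nat -> gen_submodule W),
    [/\ F 0%N =i predT, F l =i pred1 0 &
      forall i, (i < l)%N -> exists le : {subset F i.+1 <= F i},
        irreducible_V_module (subquotient le)].

End ModuleClasses.

Section Cofiniteness.
Variable V : voa.

Definition V_plus : {pred V} :=
  lspan [set v | exists2 n : int, 0 < n & v \in voa_gr V n].

Definition C1 : submodClosed V :=
  lspan ([set w | exists u v, [/\ u \in V_plus, v \in V_plus &
                                w = voa_Y u (- 1) v]] `|`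
        [set w | exists v, w = voa_L (- 1) v]).

Definition C1_cofinite : Prop := fin_dim (predT : {pred quot_space C1}).

(* A(A-1)...(A-j+1) *)
Fixpoint op_falling (A : V -> V) (j : nat) (v : V) : V :=
  if j is j'.+1 then A (op_falling A j' v) - j'%:R *: op_falling A j' v else v.

Definition op_binom (A : V -> V) (j : nat) (v : V) : V :=
  (j`!%:R : C)^-1 *: op_falling A j v.

(* w = Res_x x^p Y((1+x)^(L(0)+n) u, x) v, where
   (1+x)^(L(0)+n) = sum_j binom(L(0)+n, j) x^j; only finitely many j
   contribute to the residue. *)
Definition is_residue (p : int) (n : nat) (u v w : V) : Prop :=
  exists N : nat, forall K : nat, (N <= K)%N ->
    \sum_(j < K)
      voa_Y (op_binom (fun a => voa_L 0 a + n%:R *: a) j u) (p + j%:Z) v = w.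

Definition Zhu_O (n : nat) : submodClosed V :=
  lspan ([set w | exists u v, is_residue (- (2 * n + 2)%N%:Z) n u v w] `|`
        [set w | exists u, w = voa_L (- 1) u + voa_L 0 u]).

(* The underlying vector space of the associative algebra A_n(V); its
   multiplication plays no role in its dimension. *)
Definition Zhu_algebra (n : nat) : lmodType C := quot_space (Zhu_O n).

End Cofiniteness.

End VertexOperatorAlgebra.

(* Main.v *)
From HB Require Import structures.
Require Import Defs.
From mathcomp Require Import all_boot all_order all_algebra.
From mathcomp Require Import boolp classical_sets reals complex.
From mathcomp Require Import zify ring.
Import Order.TTheory GRing.Theory Num.Theory.
Set Implicit Arguments.
Unset Strict Implicit.
Unset Printing Implicit Defensive.
Local Open Scope ring_scope.

(* On a vector y of weight lam such that no lam - k (k >= 1) is a weight, the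
   zero modes o(v) = v_(wt v - 1) annihilate O_N(V), and o(omega * v)y =
   lam o(v)y.  As A_N(V) is finite dimensional, some *-power of omega is a
   combination of lower ones modulo O_N(V), so lam is a root of a fixed monic
   polynomial.  Hence there is a finite set r of weights such that every nonzero
   lower-truncated module, in particular every nonzero subquotient of a
   grading-restricted W, has a weight in r.  A strict inclusion of submodules of
   W is therefore strict in some W_[lam] with lam in r; these are finitely many
   finite-dimensional spaces, so W has finite length.  Conversely the weights of
   an irreducible V-module lie in a single coset of Z, so irreducible V-modules,
   and then finite-length modules, are quasi-finite dimensional. *)

Local Notation span s := (lspan [set x | x \in s]).

(** * Spans, finite dimension and the rank of a subspace *)

Section LinearAlgebra.
Variables (K : fieldType).
Implicit Types (V W : lmodType K).

(** Packs a closed predicate as a subspace on the spot, so that [lspan_sub] serves as an induction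
    principle over spans. *)
Definition submod_of V (S : {pred V}) (SC : submod_closed S) : submodClosed V :=
  HB.pack S (GRing.isSubmodClosed.Build K V S SC).

Lemma submodB V (S : submodClosed V) : {in S &, forall u v, u - v \in S}.
Proof. by move=> u v uS vS; rewrite -scaleN1r rpredD ?rpredZ. Qed.

Lemma preim_closed V W (f : V -> W) (S : submodClosed W) : linear f ->
  submod_closed [pred v | f v \in S].
Proof.
move=> lf; have f0 : f 0 = 0 by have := lf (-1) 0 0; rewrite !scaleN1r !addNr.
split=> [|a u v]; rewrite !inE ?f0 ?rpred0 // => fu fv.
by rewrite lf rpredD ?rpredZ.
Qed.

Lemma ker_closed V W (f : {linear V -> W}) : submod_closed [pred v | f v == 0].
Proof.
split=> [|a u v]; rewrite !inE ?linear0 // => /eqP fu /eqP fv.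
by rewrite linearP fu fv scaler0 addr0.
Qed.

Lemma mem_lspan V (A : set V) x : A x -> x \in lspan A.
Proof.
move=> Ax; apply/asboolP; exists [:: (1, x)]; split.
  by move=> p; rewrite inE => /eqP->.
by rewrite big_seq1 scale1r.
Qed.

Lemma lspan_sub V (A : set V) (S : submodClosed V) :
  (forall x, A x -> x \in S) -> {subset lspan A <= S}.
Proof.
move=> AS _ /asboolP[s [sA ->]]; rewrite big_seq; apply: rpred_sum => p ps.
by rewrite rpredZ // AS //; apply: sA.
Qed.

Lemma lspan_mono V (A B : set V) : (forall x, A x -> B x) ->
  forall w, w \in lspan A -> w \in lspan B.
Proof. by move=> AB; apply: (@lspan_sub _ A (lspan B)) => x /AB/mem_lspan. Qed.

Lemma mem_span_map (I : eqType) V (f : I -> V) (s : seq I) i :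
  i \in s -> f i \in span (map f s).
Proof. by move=> si; apply: mem_lspan; apply: (@map_f I V). Qed.

Lemma span_map_sub (I : eqType) V (f : I -> V) (s : seq I)
    (S : submodClosed V) :
  {in s, forall i, f i \in S} -> {subset span (map f s) <= S}.
Proof.
move=> fS; apply: lspan_sub => x /= xs.
by have /mapP[i si ->] : x \in map f s := xs; apply: fS.
Qed.

Lemma span_consP V (x w : V) s :
  reflect (exists a, exists2 y, y \in span s & w = a *: x + y)
          (w \in span (x :: s)).
Proof.
apply: (iffP idP) => [|[a [y ys ->]]].
  case/asboolP=> t [tA ->]; elim: t tA => [|p t IH] tA.
    by exists 0, 0; rewrite ?rpred0 // big_nil scale0r addr0.
  have [|a [y ys e]] := IH.
    by move=> q qt; apply: tA; rewrite inE qt orbT.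
  rewrite big_cons e; have /= := tA p (mem_head _ _).
  rewrite inE => /orP[/eqP->|ps].
    by exists (p.1 + a), y; rewrite // scalerDl addrA.
  exists a, (p.1 *: p.2 + y); last by rewrite addrCA.
  by rewrite rpredD ?rpredZ // mem_lspan.
apply: rpredD; first by rewrite rpredZ // mem_lspan //= mem_head.
by apply: lspan_mono ys => z /= zs; rewrite inE zs orbT.
Qed.

Lemma lspan_nil V (w : V) : w \in span [::] -> w = 0.
Proof.
move=> /asboolP[[|p s] [sA ->]]; first by rewrite big_nil.
by have := sA p (mem_head _ _).
Qed.

Lemma image_span V W (f : {linear V -> W}) s w :
  w \in span s -> f w \in span (map f s).
Proof.
elim: s w => [|x s IH] w; first by move/lspan_nil->; rewrite linear0 rpred0.
case/span_consP=> a [y ys ->]; apply/span_consP; exists a, (f y).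
  exact: IH.
by rewrite linearP.
Qed.

Lemma lift_span V W (f : {linear V -> W}) s w :
  w \in span (map f s) -> exists2 v, v \in span s & w = f v.
Proof.
elim: s w => [|x s IH] w.
  by move/lspan_nil->; exists 0; rewrite ?rpred0 ?linear0.
case/span_consP=> a [_ /IH[y ys ->] ->]; exists (a *: x + y); last first.
  by rewrite linearP.
by apply/span_consP; exists a, y.
Qed.

Lemma map_lift (A B : eqType) (f : A -> B) (P : pred A) (s : seq B) :
  {in s, forall y, exists2 x, P x & y = f x} ->
  exists2 t, all P t & s = map f t.
Proof.
elim: s => [|y s IH] h; first by exists [::].
have [|t tP ->] := IH; first by move=> z zs; apply: h; rewrite inE zs orbT.
by have [x xP ->] := h y (mem_head _ _); exists (x :: t); rewrite //= xP.
Qed.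

Lemma fin_dim_mem V (S : {pred V}) (s : seq V) :
  S =i span s -> {subset s <= S}.
Proof. by move=> e x xs; rewrite e mem_lspan. Qed.

(** Induction on [s]: the part of [U] mapped into the span of the tail has codimension at most one,
    and a vector with head coefficient 1 is the missing generator. If there is none, rescaling shows
    that all of [U] maps into the span of the tail. *)
Lemma fin_dim_inj V W (f : {linear V -> W}) (U : submodClosed V)
    (s : seq W) :
  injective f -> (forall u, u \in U -> f u \in span s) -> fin_dim U.
Proof.
move=> fI; elim: s U => [|x s IH] U Us.
  exists [::] => u; apply/idP/idP => [/Us/lspan_nil e|/lspan_nil->].
    by rewrite (_ : u = 0) ?rpred0 //; apply: fI; rewrite e linear0.
  exact: rpred0.
have UC : submod_closed [pred u | (u \in U) && (f u \in span s)].
  split=> [|a u v]; first by apply/andP; rewrite linear0 !rpred0.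
  move=> /andP[uU us] /andP[vU vs]; apply/andP.
  by rewrite linearP !rpredD ?rpredZ.
have [|t tE] := IH (submod_of UC); first by move=> u /andP[].
have [[u uU [y ys fu]]|no] :=
    pselect (exists2 u, u \in U & exists2 y, y \in span s & f u = x + y).
  exists (u :: t) => w; apply/idP/idP => [wU|].
    have /span_consP[a [z zs fw]] := Us w wU.
    apply/span_consP; exists a, (w - a *: u); last by rewrite addrC subrK.
    rewrite -tE; apply/andP; split; first by rewrite submodB ?rpredZ.
    rewrite linearB linearZ /= fw fu scalerDr opprD addrACA subrr add0r.
    by rewrite submodB ?rpredZ.
  case/span_consP=> a [z]; rewrite -tE => /andP[zU _] ->.
  by rewrite rpredD ?rpredZ.
apply: IH => u uU; have /span_consP[a [y ys fu]] := Us u uU.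
have [a0|a0] := eqVneq a 0; first by rewrite fu a0 scale0r add0r.
case: no; exists (a^-1 *: u); first by rewrite rpredZ.
exists (a^-1 *: y); first by rewrite rpredZ.
by rewrite linearZ /= fu scalerDr scalerA mulVf ?scale1r.
Qed.

Lemma fin_dim_sub V (U : submodClosed V) (s : seq V) :
  {subset U <= span s} -> fin_dim U.
Proof. by move=> Us; apply: (@fin_dim_inj _ _ idfun U s). Qed.

(* The dimension of S :&: span s when s is free, and in general at least
   strictly monotone in S :&: span s. *)
Fixpoint rk V (s : seq V) (S : {pred V}) : nat :=
  if s is x :: s' then
    addn `[< exists2 y, y \in span s' & x + y \in S >] (rk s' S)
  else 0%N.

Lemma rk_size V (s : seq V) (S : {pred V}) : (rk s S <= size s)%N.
Proof. by elim: s => //= x s IH; rewrite -add1n leq_add ?leq_b1. Qed.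

Lemma rk_mono V (s : seq V) (S T : {pred V}) :
  {subset S <= T} -> (rk s S <= rk s T)%N.
Proof.
move=> ST; elim: s => //= x s IH; rewrite leq_add //.
case: asboolP => // -[y ys /ST yT]; rewrite lt0b; apply/asboolP.
by exists y.
Qed.

(** Each summand of [rk] is monotone, so equal totals force equal summands. For head coefficient
    [a != 0], some [x + z] lies in [S], and its difference with [a^-1 *: w] falls under the
    induction hypothesis. *)
Lemma rk_strict V (s : seq V) (S T : submodClosed V) :
  {subset S <= T} -> (rk s T <= rk s S)%N ->
  forall w, w \in span s -> w \in T -> w \in S.
Proof.
move=> ST; elim: s => [_ w /lspan_nil-> _|x s IH /= le w]; first exact: rpred0.
have m := rk_mono s ST.
have b : (`[< exists2 y, y \in span s & (x + y)%R \in S >]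
          <= `[< exists2 y, y \in span s & (x + y)%R \in T >])%N.
  case: asboolP => // -[y ys /ST yT]; rewrite lt0b; apply/asboolP.
  by exists y.
have {}IH : forall w, w \in span s -> w \in T -> w \in S.
  apply: IH; move: b le; move: (nat_of_bool _) (nat_of_bool _) => p q; lia.
have TS : `[< exists2 y, y \in span s & x + y \in T >] ->
          `[< exists2 y, y \in span s & x + y \in S >].
  by move: b le m; do 2!case: `[< _ >] => //=; lia.
case/span_consP=> a [y ys def_w] wT.
have [a0|a0] := eqVneq a 0.
  by rewrite def_w a0 scale0r add0r in wT *; apply: IH.
have xT : x + a^-1 *: y \in T.
  have -> : x + a^-1 *: y = a^-1 *: w.
    by rewrite def_w scalerDr scalerA mulVf ?scale1r.
  by rewrite rpredZ.
have /asboolP[z zs zS] : `[< exists2 y, y \in span s & x + y \in S >].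
  by apply: TS; apply/asboolP; exists (a^-1 *: y); rewrite ?rpredZ.
have dS : a^-1 *: y - z \in S.
  apply: IH => //; first by rewrite submodB ?rpredZ.
  have -> : a^-1 *: y - z = (x + a^-1 *: y) - (x + z).
    by rewrite opprD addrACA subrr add0r.
  by rewrite submodB // ST.
have -> : w = a *: ((x + z) + (a^-1 *: y - z)).
  by rewrite [_ - z]addrC addrA addrK def_w scalerDr scalerA mulfV ?scale1r.
by rewrite rpredZ // rpredD.
Qed.

(** Otherwise each new vector strictly raises the rank of the span of its predecessors, while
    [size s] bounds it. *)
Lemma fin_dim_dependent V (x : nat -> V) : fin_dim (predT : {pred V}) ->
  exists n, x n \in span (map x (iota 0 n)).
Proof.
move=> [s sE]; apply: contrapT => no.
have rk_ge n : (n <= rk s (span (map x (iota 0 n))))%N.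
  elim: n => // n IH; apply: leq_ltn_trans IH _.
  rewrite ltnNge; apply/negP => le; apply: no; exists n.
  have xn i : (i < n.+1)%N -> x i \in span (map x (iota 0 n.+1)).
    by move=> lt; apply: mem_span_map; rewrite mem_iota.
  have sub : {subset span (map x (iota 0 n)) <= span (map x (iota 0 n.+1))}.
    by apply: span_map_sub => i; rewrite mem_iota => lt; apply: xn; lia.
  by apply: (rk_strict sub le) (xn n (ltnSn n)); rewrite -sE.
by have := leq_trans (rk_ge (size s).+1) (rk_size _ _); rewrite ltnn.
Qed.

(** Passes from repeated to distinct indices, the form in which [direct_sum] states independence. *)
Lemma sum_group V (I : eqType) (W : lmodType K) (F : I -> V -> W)
    (s : seq (I * V)) : (forall i, linear (F i)) ->
  \sum_(p <- s) F p.1 p.2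
  = \sum_(i <- undup (map fst s)) F i (\sum_(p <- s | p.1 == i) p.2).
Proof.
move=> lF; have F0 i : F i 0 = 0.
  by have := lF i (-1) 0 0; rewrite !scaleN1r !addNr.
have FD i x y : F i (x + y) = F i x + F i y.
  by have := lF i 1 x y; rewrite !scale1r.
transitivity (\sum_(i <- undup (map fst s)) \sum_(p <- s | p.1 == i) F i p.2).
  rewrite (exchange_big_dep xpredT) //= big_seq [RHS]big_seq.
  apply: eq_bigr => p ps; rewrite [RHS]big_mkcond.
  rewrite (bigD1_seq p.1) ?undup_uniq //=.
    by rewrite eqxx big1 ?addr0 // => i; rewrite eq_sym => /negbTE->.
  by rewrite mem_undup; apply: (@map_f _ I fst).
apply: eq_bigr => i _.
by rewrite (big_morph (F i) (FD i) (F0 i)).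
Qed.

End LinearAlgebra.

(** * Linear maps and eigenvectors on direct sums *)

Section DirectSum.
Variables (K : fieldType) (V : lmodType K) (I : eqType).
Variables (G : I -> submodClosed V) (dG : direct_sum G).

Lemma direct_ind (P : V -> Prop) : P 0 ->
  (forall x y, P x -> P y -> P (x + y)) ->
  (forall i x, x \in G i -> P x) -> forall x, P x.
Proof.
move=> P0 PD PG x; have [s [f [_ fG ->]]] := dG.1 x.
by elim/big_ind: _ => // i _; apply: PG (fG i).
Qed.

(** The map is built from its graph: [rel v y] says that some homogeneous decomposition of [v]
    yields [y]. Independence of the summands makes this linear relation single-valued. *)
Lemma direct_linear (W : lmodType K) (F : I -> V -> W) :
  (forall i, linear (F i)) ->
  exists f : {linear V -> W}, forall i x, x \in G i -> f x = F i x.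
Proof.
move=> lF.
have F0 i : F i 0 = 0 by have := lF i (-1) 0 0; rewrite !scaleN1r !addNr.
pose rel v y := exists t : seq (I * V), [/\ forall p, p \in t -> p.2 \in G p.1,
  v = \sum_(p <- t) p.2 & y = \sum_(p <- t) F p.1 p.2].
have total v : exists y, rel v y.
  have [s [f [_ fG ->]]] := dG.1 v.
  exists (\sum_(i <- s) F i (f i)), [seq (i, f i) | i <- s].
  split=> [p||]; rewrite ?big_map //.
  by move=> /mapP[i _ ->]; apply: fG.
have uniq0 y : rel 0 y -> y = 0.
  case=> t [tG t0 ->]; rewrite sum_group // big_seq big1 // => i it.
  pose g j := \sum_(p <- t | p.1 == j) p.2.
  have gG j : g j \in G j.
    by rewrite /g big_seq_cond; apply: rpred_sum => p /andP[/tG pt /eqP <-].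
  have g0 : \sum_(j <- undup (map fst t)) g j = 0.
    by rewrite [RHS]t0 (@sum_group _ _ _ _ (fun _ : I => idfun)).
  by rewrite -/(g i) (dG.2 _ _ (undup_uniq _) gG g0 i it).
have lin a u v y z : rel u y -> rel v z -> rel (a *: u + v) (a *: y + z).
  move=> [t [tG -> ->]] [t' [tG' -> ->]].
  exists ([seq (p.1, a *: p.2) | p <- t] ++ t'); split.
  - move=> p; rewrite mem_cat => /orP[|/tG'//].
    move/mapP=> [q /tG qG ->].
    by rewrite rpredZ.
  - by rewrite big_cat big_map scaler_sumr.
  rewrite big_cat big_map scaler_sumr; congr (_ + _); apply: eq_bigr => p _ /=.
  by have := lF p.1 a p.2 0; rewrite F0 !addr0.
have [f fP] := choice total.
have fl : linear f.
  move=> a u v; apply/eqP; rewrite -subr_eq0; apply/eqP; apply: uniq0.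
  have := lin (-1) _ _ _ _ (lin a _ _ _ _ (fP u) (fP v)) (fP (a *: u + v)).
  by rewrite !scaleN1r addNr (addrC (- _)).
pose L := GRing.isLinear.Build _ _ _ _ f fl.
pose g : {linear V -> W} := HB.pack f L.
exists g => i x xG; apply/eqP; rewrite -subr_eq0; apply/eqP; apply: uniq0.
have rx : rel x (F i x).
  exists [:: (i, x)]; split; rewrite ?big_seq1 // => p.
  by rewrite inE => /eqP->.
by have := lin (-1) _ _ _ _ rx (fP x); rewrite !scaleN1r addNr (addrC (- _)).
Qed.

(** The operator [L - c i] kills [x] and scales its component at [j] by [c j - c i], nonzero for
    [j != i]; independence then removes these components. *)
Lemma direct_eigen (L : V -> V) (c : I -> K) i x : linear L -> injective c ->
  (forall j z, z \in G j -> L z = c j *: z) -> L x = c i *: x -> x \in G i.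
Proof.
move=> lL cI Lc Lx; have [s [f [us fG def_x]]] := dG.1 x.
pose M : {linear V -> V} := HB.pack L (GRing.isLinear.Build _ _ _ _ L lL).
have e : \sum_(j <- s) (c j - c i) *: f j = 0.
  have : M x - c i *: x = 0 by rewrite /= Lx subrr.
  rewrite def_x linear_sum scaler_sumr -sumrB => z; rewrite -[RHS]z.
  by apply: eq_bigr => j _; rewrite /= (Lc j) // scalerBl.
have hG j : (c j - c i) *: f j \in G j by rewrite rpredZ.
rewrite def_x big_seq; apply: rpred_sum => j js.
have [<-//|ji] := eqVneq j i.
have /eqP := dG.2 s _ us hG e j js.
rewrite scaler_eq0 subr_eq0 (inj_eq cI) (negbTE ji) => /eqP->.
exact: rpred0.
Qed.

End DirectSum.

(** * The Jacobi identity and commutators with L(0) *)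

Section VertexAction.
Variable R : realType.
Local Notation C := R[i].
Local Notation binz := (@binz R).

Lemma binz_0 (m : int) : binz m 0 = 1.
Proof. by rewrite /binz big_ord0 divr1. Qed.

Lemma binz_1 (m : int) : binz m 1 = m%:~R.
Proof. by rewrite /binz big_ord1 subr0 divr1. Qed.

Lemma binz_nat_gt (n i : nat) : (n < i)%N -> binz n%:Z i = 0.
Proof.
move=> lt; rewrite /binz (bigD1 (Ordinal lt)) //= pmulrn subrr mul0r.
by rewrite mul0r.
Qed.

Lemma binz_2_2 : binz 2 2 = 1.
Proof.
rewrite /binz !big_ord_recl big_ord0 /= /bump /=.
by rewrite -!pmulrn (_ : 2`! = 2)%N //; field.
Qed.

Lemma sum_ord_trunc (W : zmodType) (n K : nat) (F : nat -> W) : (n <= K)%N ->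
  (forall i, (n <= i)%N -> F i = 0) -> \sum_(i < K) F i = \sum_(i < n) F i.
Proof.
move=> nK F0; rewrite -!(big_mkord xpredT F) (big_cat_nat (leq0n n) nK) /=.
by rewrite [X in _ + X]big_nat [X in _ + X]big1 ?addr0 // => i /andP[/F0].
Qed.

Variables (V : lmodType C) (Y : V -> int -> V -> V) (one omega : V) (c : C).
Variables (W : lmodType C) (YW : V -> int -> W -> W).
Hypothesis act : vertex_action Y one omega c YW.

Lemma act0 u n : YW u n 0 = 0.
Proof.
by have := va_linear_r act u n (-1) 0 0; rewrite !scaleN1r !addNr.
Qed.

Lemma actZ u n a w : YW u n (a *: w) = a *: YW u n w.
Proof. by have := va_linear_r act u n a w 0; rewrite act0 !addr0. Qed.

Lemma actB u n w w' : YW u n (w - w') = YW u n w - YW u n w'.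
Proof.
by have := va_linear_r act u n (-1) w' w; rewrite !scaleN1r !(addrC (- _)).
Qed.

Lemma act0l n w : YW 0 n w = 0.
Proof.
by have := va_linear_l act n w (-1) 0 0; rewrite !scaleN1r /= !addNr.
Qed.

Lemma actZl u n a w : YW (a *: u) n w = a *: YW u n w.
Proof. by have := va_linear_l act n w a u 0; rewrite /= act0l !addr0. Qed.

Lemma act_addl u v n w : YW (u + v) n w = YW u n w + YW v n w.
Proof. by have := va_linear_l act n w 1 u v; rewrite /= !scale1r. Qed.

Definition jacobi_l u v w (l m n : int) (i : nat) : W :=
  ((-1) ^+ i * binz l i) *:
    (YW u (m + l - i%:Z) (YW v (n + i%:Z) w)
     - (-1) ^ l *: YW v (n + l - i%:Z) (YW u (m + i%:Z) w)).

Definition jacobi_r u v w (l m n : int) (i : nat) : W :=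
  binz m i *: YW (Y u (l + i%:Z) v) (m + n - i%:Z) w.

(** In [va_jacobi] the partial sums agree only from an unspecified length on; vanishing tails allow
    each side to be cut at its own explicit length. *)
Lemma jacobi_trunc u v w l m n p q :
  (forall i, (p <= i)%N -> jacobi_l u v w l m n i = 0) ->
  (forall i, (q <= i)%N -> jacobi_r u v w l m n i = 0) ->
  \sum_(i < p) jacobi_l u v w l m n i = \sum_(i < q) jacobi_r u v w l m n i.
Proof.
move=> l0 r0; have [N] := va_jacobi act u v w l m n.
move=> /(_ (maxn N (maxn p q))); rewrite leq_maxl => /(_ isT) e.
have pK : (p <= maxn N (maxn p q))%N by lia.
have qK : (q <= maxn N (maxn p q))%N by lia.
by rewrite -(sum_ord_trunc pK l0) -(sum_ord_trunc qK r0).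
Qed.

(** The Jacobi identity with u = omega, l = 0, m = 1: the binomials leave one term on the left and
    two on the right. *)
Lemma act_commL0 v n w :
  YW omega 1 (YW v n w) - YW v n (YW omega 1 w)
  = YW (Y omega 0 v) (n + 1) w + YW (Y omega 1 v) n w.
Proof.
have := @jacobi_trunc omega v w 0 1 n 1 2.
rewrite big_ord1 !big_ord_recl big_ord0 /jacobi_l /jacobi_r /= /bump /=.
rewrite !binz_0 binz_1 !(expr0z, expr0, mul1r, scale1r, addr0, subr0, add0r).
rewrite (addrC n 1) (addrAC 1 n) subrr add0r; apply=> i i1.
  by rewrite (binz_nat_gt i1) mulr0 scale0r.
by rewrite (binz_nat_gt i1) scale0r.
Qed.

(** The derivative axiom turns the mode n + 1 of L(-1)v into -(n + 1) v_n in the commutator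
    formula. *)
Lemma act_weight (k : C) v n w : Y omega 1 v = k *: v ->
  YW omega 1 (YW v n w)
  = YW v n (YW omega 1 w) + (k - n%:~R - 1) *: YW v n w.
Proof.
move=> kv; apply/eqP; rewrite addrC -subr_eq act_commL0 kv actZl; apply/eqP.
have := va_derivative act v (n + 1) w; rewrite /vir addNr => ->.
by rewrite addrK -scalerDl rmorphN rmorphD /=; congr (_ *: _); ring.
Qed.

End VertexAction.

(** * Weight shifts, lowest eigenvectors and zero modes *)

Section Weights.
Variables (R : realType) (V : voa R).
Local Notation C := R[i].

Lemma voa_weight (a b n : int) u v : u \in voa_gr V a -> v \in voa_gr V b ->
  voa_Y u n v \in voa_gr V (a + b - n - 1).
Proof.
move=> /voa_L0 ua /voa_L0 vb.
apply: (direct_eigen (@voa_direct R V)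
  (va_linear_r (voa_action V) (voa_omega V) 1) (@mulrIz C _ (oner_neq0 _))).
  by move=> j z /voa_L0.
rewrite /vir !add0r in ua vb.
rewrite (act_weight (voa_action V) n v ua) vb (actZ (voa_action V)) -scalerDl.
by rewrite !rmorphB rmorphD /=; congr (_ *: _); ring.
Qed.

Variable W : gen_module V.
Implicit Types (w y : W) (lam : C).

(** The mode u_n intertwines L(0) - lam with L(0) - (lam + a - n - 1), so the power that kills [w]
    also kills its image. *)
Lemma gm_weight (a n : int) u w lam : u \in voa_gr V a -> w \in gm_gr W lam ->
  gm_Y u n w \in gm_gr W (lam + (a - n - 1)%:~R).
Proof.
move=> /voa_L0 ua /gm_L0[k kw]; apply/gm_L0; exists k.
rewrite /vir !add0r in ua kw *.
have e (x : W) : gm_Y (voa_omega V) 1 (gm_Y u n x)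
    - (lam + (a - n - 1)%:~R) *: gm_Y u n x
    = gm_Y u n (gm_Y (voa_omega V) 1 x - lam *: x).
  rewrite (act_weight (gm_action W) n x ua) (actB (gm_action W)).
  rewrite (actZ (gm_action W)) -addrA; congr (_ + _).
  by rewrite -scalerBl -scaleNr; congr (_ *: _); rewrite !rmorphB /=; ring.
have ek (x : W) : iter k (fun x => gm_Y (voa_omega V) 1 x
    - (lam + (a - n - 1)%:~R) *: x) (gm_Y u n x)
    = gm_Y u n (iter k (fun x => gm_Y (voa_omega V) 1 x - lam *: x) x).
  by elim: k {kw} => //= k ->; rewrite e.
by rewrite ek kw (act0 (gm_action W)).
Qed.

(* The weight lam is lowest only within its coset lam + Z. *)
Definition lowest_eigenvector lam y : Prop :=
  [/\ y \in gm_gr W lam, gm_L 0 y = lam *: y &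
      forall k : nat, (0 < k)%N -> gm_gr W (lam - k%:R) =i pred1 0].

(** The image would have weight lam - (n - a + 1), a positive integer below lam. *)
Lemma lower_weight0 lam y (a n : int) u w : lowest_eigenvector lam y ->
  u \in voa_gr V a -> w \in gm_gr W lam -> a <= n -> gm_Y u n w = 0.
Proof.
move=> [_ _ low] ua wlam an; have := gm_weight n ua wlam.
have -> : (a - n - 1)%:~R = - (`|n - a|%N.+1)%:R :> C.
  have -> : a - n - 1 = - (`|n - a|%N.+1)%:Z by lia.
  by rewrite rmorphN.
by rewrite low // inE => /eqP.
Qed.

(* f is v |-> o(v)y. *)
Lemma zero_mode y : exists f : {linear V -> W},
  forall k v, v \in voa_gr V k -> f v = gm_Y v (k - 1) y.
Proof.
apply: (direct_linear (@voa_direct R V)) => k.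
exact: (va_linear_l (gm_action W)).
Qed.

End Weights.

(** * Zero modes on lowest eigenvectors and the spaces O_n(V) *)

Section Zhu.
Variables (R : realType) (V : voa R).
Local Notation C := R[i].

(* Zhu's product omega * v = Res_x x^-1 Y((1+x)^(L(0)) omega, x) v. *)
Definition omega_star (v : V) : V :=
  voa_L (- 2) v + 2%:R *: voa_L (- 1) v + voa_L 0 v.

Lemma omega_starD u v : omega_star (u + v) = omega_star u + omega_star v.
Proof.
have lD n : voa_L n (u + v) = voa_L n u + voa_L n v.
  have := va_linear_r (voa_action V) (voa_omega V) (n + 1) 1 u v.
  by rewrite !scale1r.
by rewrite /omega_star !lD scalerDr [X in X + _ = _]addrACA [LHS]addrACA.
Qed.

Lemma omega_star0 : omega_star 0 = 0.
Proof.
by rewrite /omega_star /voa_L /vir !(act0 (voa_action V)) scaler0 !addr0.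
Qed.

Variables (W : gen_module V) (lam : C) (y : W).
Hypothesis low : lowest_eigenvector lam y.
Variable f : {linear V -> W}.
Hypothesis f_mode : forall k v, v \in voa_gr V k -> f v = gm_Y v (k - 1) y.

Lemma zero_mode_one : f (voa_one V) = y.
Proof.
by rewrite (f_mode (voa_one_gr V)) (va_vacuum (gm_action W)).
Qed.

Lemma zero_mode_omega_star v : f (omega_star v) = lam *: f v.
Proof.
have [yl L0y _] := low.
elim/(direct_ind (@voa_direct R V)): v => [|u v eu ev|b v vb].
- by rewrite omega_star0 !(linear0 f) scaler0.
- by rewrite omega_starD linearD eu ev (linearD f) scalerDr.
have om := voa_omega_gr V.
have og n := voa_weight n om vb.
(* Take l = -1, m = 2, n = b - 1. On the left only i = 0 survives, and its second half vanishes
   since omega_2 lowers the weight of [y]. On the right the coefficients 1, 2, 1 produce the three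
   terms of [omega_star]. *)
have := @jacobi_trunc _ _ _ _ _ _ _ _ (gm_action W) (voa_omega V) v y
  (- 1) 2 (b - 1) 1 3.
rewrite big_ord1 !big_ord_recl big_ord0 /jacobi_l /jacobi_r /= /bump /=.
rewrite !binz_0 binz_1 binz_2_2 !(expr0, mul1r, scale1r, addr0, subr0).
rewrite (lower_weight0 low om yl) // (act0 (gm_action W)) scaler0 subr0.
rewrite (_ : gm_Y (voa_omega V) (2 - 1) _ = lam *: f v); last first.
  rewrite (f_mode vb) (_ : 2 - 1 = 1) //.
  rewrite (act_weight (gm_action W) _ _ (voa_L0 vb)).
  have -> : gm_Y (voa_omega V) 1 y = lam *: y by [].
  rewrite (actZ (gm_action W)) rmorphB /= opprB addrCA subrr addr0.
  by rewrite subrr scale0r addr0.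
move=> -> //.
- rewrite /omega_star !linearD linearZ /voa_L /vir /=.
  rewrite (f_mode (og _)) (f_mode (og _)) (f_mode (og _)) addrA.
  congr (gm_Y _ _ _ + _ *: gm_Y _ _ _ + gm_Y _ _ _) => //; lia.
- move=> i i1; have vy : gm_Y v (b - 1 + i%:Z) y = 0.
    by apply: (lower_weight0 low vb yl); lia.
  have oy : gm_Y (voa_omega V) (2 + i%:Z) y = 0.
    by apply: (lower_weight0 low om yl); lia.
  by rewrite vy oy !(act0 (gm_action W)) scaler0 subr0 scaler0.
- by move=> i i3; rewrite (binz_nat_gt _ i3) scale0r.
Qed.

(** For [u] of weight k the zero mode of L(-1)u is its mode k, equal to -k u_(k-1), which cancels k
    o(u). *)
Lemma zero_mode_L u : f (voa_L (- 1) u + voa_L 0 u) = 0.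
Proof.
elim/(direct_ind (@voa_direct R V)): u => [|u v eu ev|k u uk].
- by rewrite /voa_L /vir !(act0 (voa_action V)) addr0 linear0.
- have lD n : voa_L n (u + v) = voa_L n u + voa_L n v.
    have := va_linear_r (voa_action V) (voa_omega V) (n + 1) 1 u v.
    by rewrite !scale1r.
  by rewrite !lD addrACA linearD eu ev addr0.
have om := voa_omega_gr V.
rewrite /voa_L (voa_L0 uk) linearD linearZ /= (f_mode uk).
rewrite (f_mode (voa_weight (-1 + 1) om uk)).
rewrite (va_derivative (gm_action W)).
rewrite (_ : 2 + k - (-1 + 1) - 1 - 1 = k); last by lia.
by rewrite -scalerDl rmorphN /= addNr scale0r.
Qed.

Section Residue.
Variables (n : nat) (p : int).
Hypothesis p_def : p = - (2 * n + 2)%N%:Z.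
Let A (a : V) : V := voa_L 0 a + n%:R *: a.

Lemma op_falling_linear j : linear (op_falling A j).
Proof.
have lA : linear A.
  move=> a u v; rewrite /A /voa_L /vir (va_linear_r (voa_action V)) !scalerDr.
  by rewrite addrACA !scalerA (mulrC a).
elim: j => [|j IH] a u v //=; rewrite !IH.
exact: (shift_linear lA j%:R).
Qed.

Lemma op_binom0 j : op_binom A j 0 = 0.
Proof.
have := op_falling_linear j (-1) 0 0; rewrite !scaleN1r !addNr => e.
by rewrite /op_binom e scaler0.
Qed.

Lemma op_binomD j u v : op_binom A j (u + v) = op_binom A j u + op_binom A j v.
Proof.
have := op_falling_linear j 1 u v; rewrite !scale1r => e.
by rewrite /op_binom e scalerDr.
Qed.

(** On weight a the operator (1+x)^(L(0)+n) is the scalar series (1+x)^(a+n), whose coefficients are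
    those on the right of the Jacobi identity. *)
Lemma op_binom_weight j a u : u \in voa_gr V a ->
  op_binom A j u = binz R (a + n%:Z) j *: u.
Proof.
move=> ua; have Au : A u = (a + n%:Z)%:~R *: u.
  by rewrite /A /voa_L (voa_L0 ua) -scalerDl rmorphD.
have AZ c : A (c *: u) = c *: A u.
  by rewrite /A /voa_L /vir (actZ (voa_action V)) scalerDr !scalerA (mulrC c).
have e : op_falling A j u = (\prod_(i < j) ((a + n%:Z)%:~R - i%:R)) *: u.
  elim: j => [|j IH]; first by rewrite big_ord0 scale1r.
  rewrite big_ord_recr /= IH AZ Au !scalerA -scalerBl mulrC -mulrBl.
  by rewrite mulrC.
by rewrite /op_binom e scalerA /binz mulrC.
Qed.

Lemma zero_mode_residue_eventually u v : exists N : nat, forall K, (N <= K)%N ->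
  f (\sum_(j < K) voa_Y (op_binom A j u) (p + j%:Z) v) = 0.
Proof.
elim/(direct_ind (@voa_direct R V)): u => [|u u' [N NP] [N' NP']|a u ua].
- exists 0%N => K _; rewrite big1 ?linear0 // => i _.
  by rewrite op_binom0 (act0l (voa_action V)).
- exists (maxn N N') => K; rewrite geq_max => /andP[NK NK'].
  under eq_bigr do rewrite op_binomD (act_addl (voa_action V)).
  by rewrite big_split linearD /= NP // NP' // addr0.
elim/(direct_ind (@voa_direct R V)): v => [|v v' [N NP] [N' NP']|b v vb].
- exists 0%N => K _; rewrite big1 ?linear0 // => i _.
  by rewrite (act0 (voa_action V)).
- exists (maxn N N') => K; rewrite geq_max => /andP[NK NK'].
  have aD x m : voa_Y x m (v + v') = voa_Y x m v + voa_Y x m v'.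
    by have := va_linear_r (voa_action V) x m 1 v v'; rewrite !scale1r.
  under eq_bigr do rewrite aD.
  by rewrite big_split linearD /= NP // NP' // addr0.
have [yl L0y _] := low.
(* The right side is the zero mode of the residue. Every term on the left contains v_(b+n+i) y or
   u_(a+n+i) y, and both vanish because these modes lower the weight of [y]. *)
have [N NP] := va_jacobi (gm_action W) u v y p (a + n%:Z) (b + n%:Z).
exists N => K /NP e; rewrite linear_sum.
transitivity (\sum_(i < K) binz R (a + n%:Z) i *:
    gm_Y (voa_Y u (p + i%:Z) v) (a + n%:Z + (b + n%:Z) - i%:Z) y).
  apply: eq_bigr => i _; rewrite (op_binom_weight _ ua) (actZl (voa_action V)).
  rewrite linearZ /= (f_mode (voa_weight _ ua vb)); congr (_ *: gm_Y _ _ _).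
  (* For p = -2n - 2 the Jacobi index a + b + 2n - i is the zero-mode index of u_(p+i) v. *)
  by rewrite p_def; lia.
rewrite -e big1 // => i _.
have vy : gm_Y v (b + n%:Z + i%:Z) y = 0.
  by apply: (lower_weight0 low vb yl); lia.
have uy : gm_Y u (a + n%:Z + i%:Z) y = 0.
  by apply: (lower_weight0 low ua yl); lia.
by rewrite vy uy !(act0 (gm_action W)) scaler0 subr0 scaler0.
Qed.

End Residue.

Lemma zero_mode_Zhu_O n v : v \in Zhu_O V n -> f v = 0.
Proof.
move=> vO; apply/eqP; move: v vO.
apply: (@lspan_sub _ _ _ (submod_of (ker_closed f))).
move=> w [[u [v [N NP]]]|[u ->]]; apply/eqP; last exact: zero_mode_L.
have [N' NP'] := @zero_mode_residue_eventually n _ (erefl _) u v.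
by rewrite -(NP (maxn N N')) ?leq_maxl // NP' ?leq_maxr.
Qed.

End Zhu.

(** A linear relation among the powers [x i] modulo O_n(V), evaluated by zero modes on [y], becomes
    a polynomial equation for [lam]. *)
Lemma lowest_weights_finite (R : realType) (V : voa R) (n : nat) :
  fin_dim (predT : {pred Zhu_algebra V n}) ->
  exists r : seq R[i], forall (W : gen_module V) lam (y : W), y != 0 ->
    lowest_eigenvector lam y -> lam \in r.
Proof.
pose x i := iter i (@omega_star R V) (voa_one V).
move=> /(fin_dim_dependent (quot_pi (Zhu_O V n) \o x)) [d].
rewrite (map_comp (quot_pi (Zhu_O V n))) => /lift_span[v vd].
move=> /eqP; rewrite -subr_eq0 -raddfB quot_pi_eq0 => dO.
(* The polynomial [q] must not depend on the module, on [lam] or on [y]: this makes the list [r]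
   universal. *)
pose evals (v : V) (q : {poly R[i]}) := forall (W : gen_module V) lam (y : W)
  (f : {linear V -> W}), lowest_eigenvector lam y ->
  (forall k v, v \in voa_gr V k -> f v = gm_Y v (k - 1) y) ->
  f v = q.[lam] *: y.
have xE i : evals (x i) 'X^i.
  move=> W lam y f low fm; elim: i => [|i IH].
    by rewrite hornerXn expr0 scale1r (zero_mode_one fm).
  by rewrite /x /= (zero_mode_omega_star low fm) IH !hornerXn scalerA exprS.
have SC : submod_closed
    [pred v | `[< exists2 q : {poly R[i]}, (size q <= d)%N & evals v q >]].
  split=> [|a u w].
    apply/asboolP; exists 0; first by rewrite size_poly0.
    by move=> W lam y f _ _; rewrite linear0 horner0 scale0r.
  move=> /asboolP[q sq qE] /asboolP[q' sq' qE']; apply/asboolP.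
  exists (a *: q + q').
    apply: leq_trans (size_polyD _ _) _; rewrite geq_max sq' andbT.
    exact: leq_trans (size_scale_leq _ _) sq.
  move=> W lam y f low fm; rewrite linearP hornerD hornerZ scalerDl -scalerA.
  by rewrite -(qE _ _ _ _ low fm) -(qE' _ _ _ _ low fm).
have /asboolP[q sq qE] : v \in submod_of SC.
  apply: (span_map_sub _ vd) => i; rewrite mem_iota => id.
  by apply/asboolP; exists 'X^i => //; rewrite size_polyXn.
(* As [size q <= d], the polynomial ['X^d - q] is nonzero, and [r] lists its roots. *)
have [r rE] := closed_field_poly_normal ('X^d - q).
exists r => W lam y y0 low; have [f fm] := zero_mode y.
have : root ('X^d - q) lam.
  have /eqP := zero_mode_Zhu_O low fm dO.
  rewrite linearB (xE _ _ _ _ _ low fm) (qE _ _ _ _ low fm) -scalerBl.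
  by rewrite scaler_eq0 (negbTE y0) orbF /root hornerD hornerN.
rewrite {}rE rootZ ?root_prod_XsubC // lead_coef_eq0 subr_eq0.
by apply: contraTneq sq => <-; rewrite size_polyXn ltnn.
Qed.

(** * Submodules from homogeneous generators; existence of lowest eigenvectors *)

Section GenModules.
Variables (R : realType) (V : voa R).
Local Notation C := R[i].
Local Notation Re := complex.Re.
Implicit Type W : gen_module V.

(** Collecting the terms of a combination by weight shows that the span is graded. Bilinearity of
    the action reduces stability to homogeneous [u] and generators. *)
Lemma gen_submodule_span W (A : set W) :
  (forall x, A x -> exists n, x \in gm_gr W n) ->
  (forall a u n x, u \in voa_gr V a -> A x -> gm_Y u n x \in lspan A) ->
  exists S : gen_submodule W, S =i lspan A.
Proof.
move=> Ah Ast.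
have st u n w : w \in lspan A -> gm_Y u n w \in lspan A.
  move=> wA; elim/(direct_ind (@voa_direct R V)): u => [|u v uA vA|a u ua].
  - by rewrite (act0l (gm_action W)) rpred0.
  - by rewrite (act_addl (gm_action W)) rpredD.
  have kC := preim_closed (lspan A) (va_linear_r (gm_action W) u n).
  by apply: (@lspan_sub _ _ _ (submod_of kC)) wA => x Ax; exact: Ast ua Ax.
have [wt wtP] : exists wt : W -> C, forall x, A x -> x \in gm_gr W (wt x).
  have /choice[g gP] : forall x, exists n, A x -> x \in gm_gr W n.
    by move=> x; have [/Ah[n]|] := pselect (A x); [exists n | exists 0].
  by exists g.
have gr w : w \in lspan A -> exists s : seq C, exists f : C -> W,
    [/\ uniq s, forall n, f n \in gm_gr W n, forall n, f n \in lspan A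
      & w = \sum_(n <- s) f n].
  case/asboolP=> t [tA ->].
  pose t' := [seq (wt p.2, p.1 *: p.2) | p <- t].
  have t'P p : p \in t' -> p.2 \in gm_gr W p.1 /\ p.2 \in lspan A.
    by move=> /mapP[q /tA qA ->]; rewrite /= !rpredZ ?mem_lspan //; apply: wtP.
  exists (undup (map fst t')), (fun n => \sum_(p <- t' | p.1 == n) p.2).
  split; first exact: undup_uniq.
  - move=> n; rewrite big_seq_cond; apply: rpred_sum => p.
    by case/andP=> /t'P[pG _] /eqP<-.
  - move=> n; rewrite big_seq_cond; apply: rpred_sum => p.
    by case/andP=> /t'P[_ pA] _.
  rewrite -(@sum_group _ _ _ _ (fun _ : C => idfun)) //=.
  by rewrite big_map.
by exists (@GenSubmodule _ _ _ (lspan A : submodClosed W) st gr).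
Qed.

Lemma homog_neq0 W (w : W) : w != 0 -> exists n x, x \in gm_gr W n /\ x != 0.
Proof.
apply: contra_neqP => no.
elim/(direct_ind (gm_direct W)): w => // [x y -> ->|n x xn]; first exact: addr0.
by apply: contrapT => /eqP x0; apply: no; exists n, x.
Qed.

Lemma total_submodule W : exists S : gen_submodule W, S =i predT.
Proof.
have [||S SE] := @gen_submodule_span W [set x | exists n, x \in gm_gr W n].
- by [].
- move=> a u n x ua [m xm]; apply: mem_lspan; eexists; exact: gm_weight ua xm.
exists S => w; rewrite SE [RHS]inE.
elim/(direct_ind (gm_direct W)): w => [|x y xA yA|n x xn].
- exact: rpred0.
- exact: rpredD.
- by apply: mem_lspan; exists n.
Qed.

Lemma zero_submodule W : exists S : gen_submodule W, S =i pred1 0.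
Proof.
have [x []|a u n x _ []|S SE] := @gen_submodule_span W set0.
exists S => w; rewrite SE [RHS]inE; apply/idP/eqP => [|->].
  have h : {subset lspan set0 <= lspan [set y : W | y \in [::]]}.
    exact: lspan_sub.
  by move=> /h /lspan_nil.
exact: (rpred0 (lspan set0)).
Qed.

Lemma weight_projection W (P : pred C) : exists g : {linear W -> W},
  forall n x, x \in gm_gr W n -> g x = if P n then x else 0.
Proof.
apply: (direct_linear (gm_direct W) (F := fun n x => if P n then x else 0)).
by move=> n a x y; case: ifP => // _; rewrite scaler0 addr0.
Qed.

(** The list gathers the weights of the components of all generators; for any other [n], projection
    to weight [n] kills the whole span. *)
Lemma span_weights W (s : seq W) : exists wl : seq C, forall n x,
  x \in gm_gr W n -> x \in span s -> x != 0 -> n \in wl.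
Proof.
have /choice[h hP] : forall x : W, exists wl : seq C, exists f : C -> W,
    (forall n, f n \in gm_gr W n) /\ x = \sum_(n <- wl) f n.
  by move=> x; have [wl [f [_ fG e]]] := (gm_direct W).1 x; exists wl, f.
exists (flatten (map h s)) => n x xn xs; apply: contra_neqT => nwl.
have [g gP] := weight_projection W (pred1 n).
have : x \in submod_of (ker_closed g).
  apply: lspan_sub xs => y /= ys; apply/eqP.
  have [f [fG ->]] := hP y; rewrite linear_sum big_seq big1 // => m my.
  rewrite (gP m) // ifN //=; apply: contraNneq nwl => <-.
  by apply/flattenP; exists (h y) => //; apply: (@map_f W (seq C)).
by rewrite inE (gP n) //= eqxx => /eqP.
Qed.

Lemma ReBnat (n : C) (k : nat) : Re (n - k%:R) = Re n - k%:R.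
Proof. by rewrite raddfB raddfMn. Qed.

(** Truncation bounds the [k] for which n - k is a weight, so a largest one exists. In that weight
    space, the last nonzero vector among the (L(0) - lam)^j z is a true eigenvector. *)
Lemma lowest_eigenvector_exists W (w : W) : lower_truncated W -> w != 0 ->
  exists lam (y : W), y != 0 /\ lowest_eigenvector lam y.
Proof.
move=> [r rP] /homog_neq0[n [x [xn x0]]].
pose P k := `[< ~ gm_gr W (n - k%:R) =i pred1 0 >].
have P0 : exists k, P k.
  exists 0%N; apply/asboolP => e; move: (e x); rewrite subr0 xn inE.
  by rewrite (negbTE x0).
have Pb k : P k -> (k <= Num.bound `|(Re n - r)%R|%R)%N.
  move=> /asboolP Pk; rewrite leqNgt; apply/negP => lt; apply: Pk; apply: rP.
  have b := archi_boundP (normr_ge0 (Re n - r)).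
  rewrite ReBnat ltrBlDr -ltrBlDl.
  by apply: le_lt_trans (ler_norm _) (lt_trans b _); rewrite ltr_nat.
have [k Pk kmax] := ex_maxnP P0 Pb.
pose lam := n - k%:R.
have low j : (0 < j)%N -> gm_gr W (lam - j%:R) =i pred1 0.
  move=> j0; apply: contrapT => nj.
  have Pkj : P (k + j)%N by apply/asboolP; rewrite natrD opprD addrA; exact: nj.
  have := kmax _ Pkj; lia.
have [z zl z0] : exists2 z, z \in gm_gr W lam & z != 0.
  apply: contrapT => no; move/asboolP: Pk; apply=> z; rewrite inE.
  apply/idP/eqP => [zl|->]; last exact: rpred0.
  by apply: contrapT => /eqP z0; apply: no; exists z.
have ex : exists j, iter j (fun x => gm_L 0 x - lam *: x) z == 0.
  by have [j jz] := (gm_L0 _ _).1 zl; exists j; apply/eqP.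
have [[|j] /eqP jz jmin] := ex_minnP ex; first by case/eqP: z0.
pose y := iter j (fun x => gm_L 0 x - lam *: x) z.
have y0 : y != 0 by apply/negP => /jmin; rewrite ltnn.
exists lam, y; split=> //; split=> //.
  by apply/gm_L0; exists 1%N.
by apply/eqP; rewrite -subr_eq0; apply/eqP.
Qed.

End GenModules.

(** * Subquotients and the correspondence of submodules *)

Section Subquotients.
Variables (R : realType) (V : voa R) (W : gen_module V).
Local Notation C := R[i].
Local Notation Re := complex.Re.
Variables (S T : gen_submodule W) (TS : {subset T <= S}).
Local Notation M := (subquotient TS).

Definition subquot_pi (z : submodule S) : M := quot_pi _ z.

Lemma subquot_pi_eq0 z : (subquot_pi z == 0) = (val z \in T).
Proof. by rewrite /subquot_pi quot_pi_eq0. Qed.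

Lemma subquot_piB y z : subquot_pi (y - z) = subquot_pi y - subquot_pi z.
Proof. exact: (raddfB (quot_pi _)). Qed.

Lemma subquot_piP (x : M) : exists z, x = subquot_pi z.
Proof. exact: quot_piP. Qed.

Lemma subquot_pi_Y u n z :
  subquot_pi (gm_Y u n z) = gm_Y u n (subquot_pi z).
Proof. exact: quot_YE. Qed.

Lemma subquot_grP n (x : M) : x \in gm_gr M n <->
  exists2 z : submodule S, val z \in gm_gr W n & x = subquot_pi z.
Proof.
split=> [/asboolP[z zn ->]|[z zn ->]]; first by exists z.
by apply/asboolP; exists z.
Qed.

Lemma subquot_lower_truncated : lower_truncated W -> lower_truncated M.
Proof.
move=> [r rP]; exists r => n /rP W0 x; rewrite [RHS]inE; apply/idP/eqP => [|->].
  move=> /subquot_grP[z]; rewrite W0 => /eqP z0 ->; apply/eqP.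
  by rewrite subquot_pi_eq0 z0 rpred0.
exact: rpred0.
Qed.

Lemma subquot_gr_fin_dim n : fin_dim (gm_gr W n) -> fin_dim (gm_gr M n).
Proof.
move=> [s sE].
have [t tE] : fin_dim (gm_gr (submodule S) n).
  apply: (@fin_dim_inj _ _ _ (val : {linear sub_space S -> W}) _ s val_inj).
  by move=> z zn; rewrite -sE.
exists (map subquot_pi t) => x; apply/idP/idP.
  move=> /subquot_grP[z zn ->]; apply: (@image_span _ _ _ (quot_pi _)).
  by rewrite -tE.
move=> /(@lift_span _ _ _ (quot_pi _))[z zt ->]; apply/subquot_grP.
by exists z => //; rewrite -tE in zt.
Qed.

(** The preimage of [Q] is presented as the span of its homogeneous elements, so that
    [gen_submodule_span] applies. *)
Lemma subquot_pullback (Q : gen_submodule M) : exists P : gen_submodule W,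
  forall w, w \in P <-> exists2 z : submodule S, subquot_pi z \in Q & w = val z.
Proof.
pose A := [set w : W | exists n, exists z : submodule S,
  [/\ subquot_pi z \in Q, w = val z & w \in gm_gr W n]]%classic.
have [||P PE] := @gen_submodule_span R V W A.
- by move=> x [n [z [_ _ xn]]]; exists n.
- move=> a u n _ ua [m [z [zQ -> zm]]]; apply: mem_lspan.
  exists (m + (a - n - 1)%:~R), (gm_Y u n z); split=> //.
    by rewrite subquot_pi_Y gs_stable.
  exact: gm_weight ua zm.
exists P => w; rewrite PE; split.
  have PC : submod_closed
      [pred w : W |
        `[< exists2 z : submodule S, subquot_pi z \in Q & w = val z >]].
    split.
      by apply/asboolP; exists 0; rewrite // /subquot_pi linear0 rpred0.
    move=> a _ _ /asboolP[x xQ ->] /asboolP[y yQ ->]; apply/asboolP.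
    exists (a *: x + y) => //.
    by rewrite /subquot_pi quot_pi_linear rpredD ?rpredZ.
  move=> wA; apply/asboolP; move: w wA.
  apply: (@lspan_sub _ _ _ (submod_of PC)).
  by move=> w [n [z [zQ -> _]]]; apply/asboolP; exists z.
(* The homogeneous components of the class of [z] lift to homogeneous [h n]. The error lies in [T],
   whose homogeneous components have class 0 and so belong to the preimage too. *)
move=> [z zQ ->]; have [s [f [us fG fQ def_z]]] := gs_graded zQ.
have /choice[h hP] : forall n, exists x : submodule S,
    val x \in gm_gr W n /\ f n = subquot_pi x.
  by move=> n; have /subquot_grP[x] := fG n; exists x.
have dT : val (z - \sum_(n <- s) h n) \in T.
  rewrite -subquot_pi_eq0 subquot_piB def_z subr_eq0; apply/eqP.
  rewrite [RHS](linear_sum (quot_pi _)); apply: eq_bigr => n _.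
  by have [_ ->] := hP n.
have -> : val z = val (z - \sum_(n <- s) h n) + \sum_(n <- s) val (h n).
  by rewrite -[X in _ + X](linear_sum (val : {linear sub_space S -> W}))
    -linearD subrK.
apply: rpredD; last first.
  apply: rpred_sum => n _; apply: mem_lspan; exists n, (h n).
  by have [hn e] := hP n; split=> //; rewrite -e.
have [s' [f' [us' fG' fT' ->]]] := gs_graded dT.
pose x n : submodule S := exist _ (f' n) (TS (fT' n)).
apply: rpred_sum => n _; apply: mem_lspan; exists n, (x n); split=> //.
have /eqP-> : subquot_pi (x n) == 0 by rewrite subquot_pi_eq0 fT'.
exact: rpred0.
Qed.

End Subquotients.

(** * Comparison of the three finiteness conditions *)

Section Finiteness.
Variables (R : realType) (V : voa R).
Local Notation C := R[i].
Local Notation Re := complex.Re.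
Implicit Type W : gen_module V.

(** Otherwise S/T has a lowest eigenvector, of weight in [r]. Its representative of that weight lies
    in [T], so the eigenvector would be 0. *)
Lemma submodule_sub_lowest W (S T : gen_submodule W) (r : seq C) :
  (forall (M : gen_module V) lam (y : M), y != 0 -> lowest_eigenvector lam y ->
    lam \in r) ->
  lower_truncated W -> {subset T <= S} ->
  (forall n w, n \in r -> w \in gm_gr W n -> w \in S -> w \in T) ->
  {subset S <= T}.
Proof.
move=> rP trW TS rT w wS; apply: contraT => wT.
have [|lam [y [y0 low]]] := lowest_eigenvector_exists
  (w := subquot_pi TS (exist _ w wS)) (subquot_lower_truncated TS trW).
  by rewrite subquot_pi_eq0.
have [/subquot_grP[z zl def_y] _ _] := low.
have lr := rP _ _ _ y0 low.
have /eqP z0 : subquot_pi TS z == 0.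
  by rewrite subquot_pi_eq0 (rT lam) //; apply: valP z.
by rewrite def_y z0 eqxx in y0.
Qed.

(** Homogeneous modes preserve L(0)-eigenvectors, so these span a submodule; a lowest eigenvector
    shows that it is nonzero. *)
Lemma irreducible_L0_semisimple W :
  lower_truncated W -> irreducible W -> L0_semisimple W.
Proof.
move=> trW [[w w0] irr].
have [lam [y [y0 [yl L0y _]]]] := lowest_eigenvector_exists trW w0.
have [||S SE] := @gen_submodule_span R V W
  [set w | exists n : C, gm_L 0 w = n *: w].
- move=> x [n nx]; exists n; apply/gm_L0; exists 1%N.
  by apply/eqP; rewrite subr_eq0; apply/eqP.
- move=> a u n x ua [m mx]; apply: mem_lspan; exists (m + (a%:~R - n%:~R - 1)).
  rewrite /gm_L /vir add0r (act_weight (gm_action W) n x (voa_L0 ua)).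
  have -> : gm_Y (voa_omega V) 1 x = m *: x by [].
  by rewrite (actZ (gm_action W)) -scalerDl.
have [S0|ST] := irr S; last by move=> x; rewrite -SE ST.
have : y \in S by rewrite SE mem_lspan //; exists lam.
by rewrite S0 inE (negbTE y0).
Qed.

(** The weight spaces over the coset n0 + Z sum to a nonzero submodule, hence to all of [W]. *)
Lemma irreducible_weights W : irreducible W -> exists n0 : C, forall n w,
  w \in gm_gr W n -> w != 0 -> exists k : int, n = n0 + k%:~R.
Proof.
move=> [[_ /homog_neq0[n0 [x0 [xn0 x0_neq0]]]] irr]; exists n0 => n w wn w0.
pose P n := `[< exists k : int, n = n0 + k%:~R >].
have [||S SE] := @gen_submodule_span R V W
  [set w | exists2 m, P m & w \in gm_gr W m].
- by move=> x [m _ xm]; exists m.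
- move=> a u m x ua [l /asboolP[k ->] xl]; apply: mem_lspan.
  exists (n0 + k%:~R + (a - m - 1)%:~R); last exact: gm_weight ua xl.
  by apply/asboolP; exists (k + (a - m - 1)); rewrite -addrA -intrD.
have [S0|ST] := irr S.
  have : x0 \in S.
    rewrite SE mem_lspan //; exists n0 => //; apply/asboolP.
    by exists 0; rewrite mulr0z addr0.
  by rewrite S0 inE (negbTE x0_neq0).
(* The projection onto the coset is thus the identity, yet it kills [w] if [n] lies outside. *)
have [g gP] := weight_projection W P.
apply/asboolP; apply: contraNT w0 => nP.
have gC : submod_closed [pred x | g x == x].
  split=> [|a x y]; rewrite !inE ?linear0 // => /eqP gx /eqP gy.
  by rewrite linearP gx gy.
have : w \in submod_of gC.
  have : w \in lspan [set w | exists2 m, P m & w \in gm_gr W m].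
    by rewrite -SE ST.
  by apply: lspan_sub => x [m Pm xm]; rewrite inE (gP m) // Pm.
by rewrite inE (gP n) // ifN // eq_sym.
Qed.

Lemma ReDint (n : C) (k : int) : Re (n + k%:~R) = Re n + k%:~R.
Proof. by rewrite raddfD raddfMz. Qed.

(** Quasi-finite dimensionality of [S], phrased for vectors of [W] so that the bounds for [T] and
    S/T combine in one space. *)
Definition weight_finite W (S : gen_submodule W) : Prop :=
  (forall r : R, exists wl : seq C, forall n w,
     Re n <= r -> w \in gm_gr W n -> w \in S -> w != 0 -> n \in wl) /\
  (forall n, exists t : seq W, forall w,
     w \in gm_gr W n -> w \in S -> w \in span t).

(** In n = n0 + k, lower truncation bounds k below and [r] bounds it above; the two lists serve
    nonnegative and negative k. *)
Lemma irreducible_weight_list W (r : R) : irreducible_V_module W ->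
  exists wl : seq C, forall n w,
    Re n <= r -> w \in gm_gr W n -> w != 0 -> n \in wl.
Proof.
move=> [[[[r0 trW] _] _] /irreducible_weights[n0 n0P]].
have := archi_boundP (normr_ge0 (r - Re n0)).
have := archi_boundP (normr_ge0 (r0 - Re n0)).
move: (Num.bound _) (Num.bound _) => b' b bP bP'.
exists ([seq n0 + k%:R | k <- iota 0 b'.+1]
        ++ [seq n0 - k%:R | k <- iota 0 b.+1]).
move=> n w nr wn w0; have [k nk] := n0P n w wn w0.
have kr : k%:~R <= r - Re n0 by rewrite lerBrDl -ReDint -nk.
have kr0 : r0 - Re n0 <= k%:~R.
  rewrite lerBlDl -ReDint -nk leNgt; apply/negP => /trW W0.
  by move: wn; rewrite W0 inE (negbTE w0).
have kb' : k < b'%:Z.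
  rewrite -(ltr_int R); apply: le_lt_trans bP'.
  exact: le_trans kr (ler_norm _).
have kb : - b%:Z < k.
  rewrite -(ltr_int R) rmorphN /=; apply: lt_le_trans kr0.
  by rewrite ltrNl; apply: le_lt_trans bP; rewrite -normrN ler_norm.
rewrite mem_cat nk; case: k {nk kr kr0} kb kb' => k kb kb'; apply/orP.
  by left; apply/mapP; exists k => //; rewrite mem_iota; lia.
right; apply/mapP; exists k.+1; first by rewrite mem_iota; lia.
by rewrite NegzE rmorphN.
Qed.

(** A vector of [S] outside [T] has a nonzero class of the same weight, so every weight comes from
    [T] or from S/T. *)
Lemma subquot_weight_finite W (S T : gen_submodule W) (TS : {subset T <= S}) :
  irreducible_V_module (subquotient TS) -> weight_finite T -> weight_finite S.
Proof.
move=> irr [Twl Tfin]; split=> [r|n].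
  have [wl wlP] := Twl r; have [wl' wlP'] := irreducible_weight_list r irr.
  exists (wl ++ wl') => n w nr wn wS w0; rewrite mem_cat; apply/orP.
  have [wT|wT] := boolP (w \in T); [left; exact: wlP wT w0 | right].
  pose x : submodule S := exist _ w wS.
  apply: (wlP' n (subquot_pi TS x)) => //; last by rewrite subquot_pi_eq0.
  by apply/subquot_grP; exists x.
have [t tP] := Tfin n; have [[[_ /(_ n)[s sE]] _] _] := irr.
(* Representatives are chosen of weight [n], so that [x - z] is a vector of [T] of weight [n],
   covered by [t]. *)
have [s' /allP s'P def_s] : exists2 s' : seq (submodule S),
    all (fun z => val z \in gm_gr W n) s' & s = map (subquot_pi TS) s'.
  apply: map_lift => x /(fin_dim_mem sE) /subquot_grP[z zn ->].
  by exists z.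
exists (map val s' ++ t) => w wn wS.
pose x : submodule S := exist _ w wS.
have : subquot_pi TS x \in gm_gr (subquotient TS) n.
  by apply/subquot_grP; exists x.
rewrite sE def_s => /(@lift_span _ _ _ (quot_pi _))[z zs' /eqP].
rewrite -subr_eq0 -subquot_piB subquot_pi_eq0 => dT.
have zspan : val z \in span (map val s').
  exact: (@image_span _ _ _ (val : {linear sub_space S -> W})).
have zn : val z \in gm_gr W n.
  by move: zspan; apply: span_map_sub => y /s'P.
have -> : w = val z + val (x - z).
  by rewrite -(linearD (val : {linear sub_space S -> W})) addrC subrK.
apply: rpredD.
  by apply: lspan_mono zspan => y /= ys; rewrite mem_cat ys.
have : val (x - z) \in span t.
  by apply: tP => //; rewrite linearB submodB.
by apply: lspan_mono => y /= ys; rewrite mem_cat ys orbT.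
Qed.

(** Finiteness climbs the series from its zero end, one irreducible quotient at a time. *)
Lemma finite_length_quasi_finite W :
  finite_length W -> quasi_finite_dimensional W.
Proof.
move=> [l [F [F0 Fl Fi]]].
have fin i : (i <= l)%N -> weight_finite (F (l - i)%N).
  elim: i => [_|i IH il].
    rewrite subn0; split=> [r|n].
      by exists [::] => n w _ _; rewrite Fl inE => /eqP->; rewrite eqxx.
    by exists [::] => w _; rewrite Fl inE => /eqP->; apply: rpred0.
  have lt : (l - i.+1 < l)%N by lia.
  have [le irr] := Fi _ lt; apply: (subquot_weight_finite irr).
  by rewrite (_ : (l - i.+1).+1 = l - i)%N; [apply: IH; lia | lia].
have [Fwl Ffin] : weight_finite (F 0%N) by rewrite -(subnn l); apply: fin.
move=> r; have [wl wlP] := Fwl r; have /choice[t tP] := Ffin.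
apply: (@fin_dim_sub _ _ _ (flatten (map t wl))).
apply: lspan_sub => w [n nr wn].
have [->|w0] := eqVneq w 0; first exact: rpred0.
have nwl : n \in wl by apply: (wlP n w) => //; rewrite F0.
have : w \in span (t n) by apply: tP; rewrite // F0.
apply: lspan_mono => y /= yt; apply/flattenP; exists (t n) => //.
exact: (@map_f C (seq W)).
Qed.

(** The part with real parts at most 0 is finite dimensional, so it has finitely many weights; minus
    the sum of their absolute real parts is a lower bound. *)
Lemma quasi_finite_grading_restricted W :
  quasi_finite_dimensional W -> grading_restricted W.
Proof.
move=> qfd; split; last first.
  move=> n; have [s sE] := qfd (Re n); apply: (@fin_dim_sub _ _ _ s) => x xn.
  by rewrite -sE mem_lspan //; exists n.
have [s sE] := qfd 0; have [wl wlP] := span_weights s.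
pose b : R := \sum_(n <- wl) `|Re n|.
have b0 : 0 <= b by apply: sumr_ge0.
exists (- b) => n nb x; rewrite [RHS]inE; apply/idP/eqP => [xn|->]; last first.
  exact: rpred0.
apply: contrapT => /eqP x0.
have nwl : n \in wl.
  apply: (wlP n x) => //; rewrite -sE mem_lspan //; exists n => //.
  by apply: ltW (lt_le_trans nb _); rewrite oppr_le0.
move: nb; rewrite ltNge => /negP; apply.
have le : `|Re n| <= b.
  rewrite /b (big_rem n) //= lerDl; exact: sumr_ge0.
by rewrite lerNl (le_trans _ le) // -normrN ler_norm.
Qed.

(** Nested submodules with equal [rk s] coincide, where [s] spans the weight spaces over [r]. The
    series always descends to a proper submodule of maximal rank. *)
Lemma grading_restricted_finite_length W (r : seq C) :
  (forall (M : gen_module V) lam (y : M), y != 0 -> lowest_eigenvector lam y ->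
    lam \in r) ->
  grading_restricted W -> finite_length W.
Proof.
move=> rP [trW finW]; have /choice[t tE] := finW.
pose s := flatten (map t r).
have sP n w : n \in r -> w \in gm_gr W n -> w \in span s.
  move=> nr; rewrite tE; apply: lspan_mono => y /= yt.
  by apply/flattenP; exists (t n) => //; apply: (@map_f C (seq W)).
have rk_sub (S T : gen_submodule W) :
    {subset T <= S} -> (rk s S <= rk s T)%N -> {subset S <= T}.
  move=> TS le; apply: (submodule_sub_lowest rP trW TS) => n w nr wn wS.
  exact: rk_strict TS le w (sP n w nr wn) wS.
have [Z ZE] := zero_submodule W.
have chain d (S : gen_submodule W) : (rk s S < d)%N ->
    exists l (F : nat -> gen_submodule W), [/\ F 0%N = S, F l =i pred1 0 &
      forall i, (i < l)%N -> exists le : {subset F i.+1 <= F i},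
        irreducible_V_module (subquotient le)].
  elim: d S => // d IH S Sd.
  have [S0|/existsNP[w0 /not_implyP[w0S w0Z]]] := pselect {subset S <= Z}.
    exists 0%N, (fun=> S); split=> // x; rewrite -ZE; apply/idP/idP => [/S0//|].
    by rewrite ZE inE => /eqP->; apply: rpred0.
  pose P k := `[< exists T : gen_submodule W,
    [/\ {subset T <= S}, ~ {subset S <= T} & rk s T = k] >].
  have exP : exists k, P k.
    exists (rk s Z); apply/asboolP; exists Z; split=> // [x|ZS].
      by rewrite ZE inE => /eqP->; apply: rpred0.
    exact: w0Z (ZS _ w0S).
  have Pb k : P k -> (k <= size s)%N.
    by move=> /asboolP[T [_ _ <-]]; apply: rk_size.
  have [k /asboolP[T [TS ST rkT]] kmax] := ex_maxnP exP Pb.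
  have [|l [F [F0 Fl Fi]]] := IH T.
    rewrite ltnS in Sd; apply: leq_trans Sd; rewrite ltnNge.
    by apply/negP => /(rk_sub _ _ TS).
  exists l.+1, (fun i => if i is j.+1 then F j else S); split=> //.
  case=> [_|i /Fi//]; rewrite F0; exists TS.
  (* A submodule [Q] pulls back to [U] between [T] and [S]. If [U] is proper, maximality of [k]
     bounds its rank by that of [T], so [U] equals [T] and [Q] is zero. *)
  have irr : irreducible (subquotient TS).
    have /existsNP[w /not_implyP[wS /negP wT]] := ST.
    split.
      by exists (subquot_pi TS (exist _ w wS)); rewrite subquot_pi_eq0.
    move=> Q; have [U UE] := subquot_pullback Q.
    have US : {subset U <= S} by move=> x /UE[z _ ->]; apply: valP z.
    have TU : {subset T <= U}.
      move=> x xT; apply/UE; exists (exist _ x (TS x xT)) => //.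
      have /eqP-> : subquot_pi TS (exist _ x (TS x xT)) == 0.
        by rewrite subquot_pi_eq0.
      exact: rpred0.
    have UQ z : val z \in U -> subquot_pi TS z \in Q.
      by move=> /UE[z' zQ /val_inj->].
    have [SU|nSU] := pselect {subset S <= U}; [right|left] => x.
      have [z ->] := subquot_piP x; rewrite [RHS]inE; apply: UQ.
      by apply: SU; apply: valP z.
    have UT : {subset U <= T}.
      apply: rk_sub => //; rewrite rkT; apply: kmax; apply/asboolP.
      by exists U.
    have [z ->] := subquot_piP x; rewrite [RHS]inE subquot_pi_eq0.
    apply/idP/idP => [zQ|zT]; last exact: UQ (TU _ zT).
    by apply: UT; apply/UE; exists z.
  split=> //; split; last first.
    exact: irreducible_L0_semisimple (subquot_lower_truncated TS trW) irr.
  split; first exact: subquot_lower_truncated.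
  by move=> n; apply: subquot_gr_fin_dim.
have [S SE] := total_submodule W.
have [l [F [F0 Fl Fi]]] := chain _ S (ltnSn _).
by exists l, F; split=> //; rewrite F0.
Qed.

End Finiteness.

Theorem proposition4p3 (R : realType) (V : voa R) :
  C1_cofinite V ->
  (exists N : nat,
    [/\ (0 < N)%N,
        forall (W1 W2 : gen_module V) (n1 n2 : R[i]),
          irreducible_V_module W1 -> irreducible_V_module W2 ->
          lowest_weight W1 n1 -> lowest_weight W2 n2 ->
          `|complex.Re n1 - complex.Re n2| <= N%:R
      & fin_dim (predT : {pred Zhu_algebra V N})]) ->
  forall W : gen_module V,
    (grading_restricted W <-> quasi_finite_dimensional W) /\
    (quasi_finite_dimensional W <-> finite_length W).
Proof.
move=> _ [N [_ _ /lowest_weights_finite[r rP]]] W.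
(* The three implications form a cycle. *)
have GF := grading_restricted_finite_length (W := W) rP.
have FQ := @finite_length_quasi_finite R V W.
have QG := @quasi_finite_grading_restricted R V W.
by split; [split=> [/GF/FQ|/QG]|split=> [/QG/GF|/FQ]].
Qed.
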